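(* Let $F$ be a field of characteristic $0$, $\Bbbk=F(t)$ with its $t$-adic valuation and valuation ring $\Bbbk^\circ$ with maximal ideal $\mathfrak{m}$, and let $R\subset\Bbbk[x_1,\dots,x_n]$ be a $\Bbbk$-subalgebra. A finite Khovanskii basis $\mathcal{F}$ of $R$ induces a toric degeneration of $\operatorname{Spec}(R)$. That is, if $R$ has a finite Khovanskii basis, then, with $R_{\Bbbk^\circ}$ the $\Bbbk^\circ$-algebra defined in the context, the morphism $\operatorname{Spec}(R_{\Bbbk^\circ})\to\operatorname{Spec}(\Bbbk^\circ)$ is flat, $\operatorname{Spec}(R_{\Bbbk^\circ})\times_{\Bbbk^\circ}\operatorname{Spec}(\Bbbk)\cong\operatorname{Spec}(R)$, and the special fiber $\operatorname{Spec}(R_{\Bbbk^\circ})\times_{\Bbbk^\circ}\operatorname{Spec}(\Bbbk^\circ/\mathfrak{m})$ is a toric variety.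
   Context: The valuation $\operatorname{val}:\Bbbk^\times\to\mathbb{Z}$ on $\Bbbk=F(t)$: $\operatorname{val}(p)$ is the unique integer $\omega$ such that $t^{-\omega}p(t)$ is defined and nonzero at $t=0$. Its valuation ring is $\Bbbk^\circ$ (elements of nonnegative valuation, and $0$), with residue field $k=\Bbbk^\circ/\mathfrak{m}= F$. For nonzero $f\in\Bbbk[x_1,\dots,x_n]$, let $\operatorname{trop}(f)(\mathbf 1)$ be the minimum of the valuations of the nonzero coefficients of $f$; the initial form is $\operatorname{in}(f)=(t^{-\operatorname{trop}(f)(\mathbf 1)}f)|_{t=0}\in k[x_1,\dots,x_n]$. For a $\Bbbk$-subalgebra $U\subseteq\Bbbk[x_1,\dots,x_n]$, the initial algebra $\operatorname{in}(U)$ is the $k$-subalgebra of $k[x_1,\dots,x_n]$ generated by the $\operatorname{in}(f)$ for nonzero $f\in U$. A subset $\mathcal{F}\subset U$ of nonzero elements is a Khovanskii basis of $U$ if $\operatorname{in}(f)$ is a monomial (up to a nonzero scalar) for every $f\in\mathcal{F}$, and $\operatorname{in}(U)$ is generated as a $k$-algebra by $\{\operatorname{in}(f): f\in\mathcal{F}\}$. $R_{\Bbbk^\circ}\subset\Bbbk^\circ[x_1,\dots,x_n]$ denotes the $\Bbbk^\circ$-subalgebra generated by $\{t^{-\operatorname{trop}(f)(\mathbf 1)}f : 0\ne f\in R\}$. A degeneration of $X$ over $\Bbbk$ is a flat family $\tilde X\to\operatorname{Spec}(\Bbbk^\circ)$ with $\tilde X\times_{\Bbbk^\circ}\operatorname{Spec}(\Bbbk)\cong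 X$; it is toric if the special fiber $\tilde X\times_{\Bbbk^\circ}\operatorname{Spec}(\Bbbk^\circ/\mathfrak m)$ is a toric variety. Toric varieties are not required to be normal: an affine toric variety is $\operatorname{Spec}$ of an affine semigroup algebra. *)

(* Defs.v *)
From HB Require Import structures.
From mathcomp Require Import all_boot all_order all_algebra.
From mathcomp Require Import generic_quotient ring_quotient fraction.
From mathcomp Require Import boolp.
From mathcomp Require Import freeg mpoly.

Set Implicit Arguments.
Unset Strict Implicit.
Unset Printing Implicit Defensive.

Import Order.TTheory GRing.Theory Num.Theory.

Local Open Scope ring_scope.
Local Open Scope quotient_scope.

(* Affine schemes over Spec A are represented by commutative rings B with a
   ring morphism A -> B (the anti-equivalence between affine schemes and
   commutative rings). Thus Spec B x_{Spec A} Spec C is Spec (B (x)_A C),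
   Spec B -> Spec A is flat when B is a flat A-module, and an isomorphism of
   schemes over Spec A is an isomorphism of rings under A. *)

Section TensorModule.
Variables (A : comPzRingType) (M N : lmodType A).

(* tensor_rel_0 makes the quotient of the monoid of formal sums a group. *)
Inductive tensor_rel : seq (M * N) -> seq (M * N) -> Prop :=
| tensor_rel_refl s : tensor_rel s s
| tensor_rel_sym s t : tensor_rel s t -> tensor_rel t s
| tensor_rel_trans s t u : tensor_rel s t -> tensor_rel t u -> tensor_rel s u
| tensor_rel_cat s s' t t' :
    tensor_rel s s' -> tensor_rel t t' -> tensor_rel (s ++ t) (s' ++ t')
| tensor_rel_catC s t : tensor_rel (s ++ t) (t ++ s)
| tensor_rel_0 n : tensor_rel [:: (0, n)] [::]
| tensor_rel_Dl m m' n : tensor_rel [:: (m + m', n)] [:: (m, n); (m', n)]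
| tensor_rel_Dr m n n' : tensor_rel [:: (m, n + n')] [:: (m, n); (m, n')]
| tensor_rel_Z a m n : tensor_rel [:: (a *: m, n)] [:: (m, a *: n)].

Definition tensor_relb (s t : seq (M * N)) : bool := `[< tensor_rel s t >].

Lemma tensor_relb_equiv : equiv_class_of tensor_relb.
Proof.
split=> [s|s t|t s u]; first exact/asboolP/tensor_rel_refl.
  by apply/asboolP/asboolP; apply: tensor_rel_sym.
by move=> /asboolP st /asboolP tu; apply/asboolP/(tensor_rel_trans st tu).
Qed.

Canonical tensor_equiv := EquivRelPack tensor_relb_equiv.
Canonical tensor_encModRel := defaultEncModRel tensor_relb.

Definition tensor := {eq_quot tensor_relb}.
HB.instance Definition _ : EqQuotient _ tensor_relb tensor :=
  EqQuotient.on tensor.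
HB.instance Definition _ := Choice.on tensor.

Lemma tensor_eqP (s t : seq (M * N)) :
  \pi_tensor s = \pi_tensor t <-> tensor_rel s t.
Proof.
split=> [/eqmodP/asboolP //|st]; exact/eqmodP/asboolP.
Qed.

Lemma tensor_rel_repr (s : seq (M * N)) :
  tensor_rel (repr (\pi_tensor s)) s.
Proof. by apply/tensor_eqP; rewrite reprK. Qed.

Definition tensor_sum (G : nmodType) (phi : M -> N -> G) (s : seq (M * N)) : G :=
  \sum_(p <- s) phi p.1 p.2.

Definition tensor_zero : tensor := \pi_tensor [::].
Definition tensor_add (x y : tensor) : tensor := \pi_tensor (repr x ++ repr y).
Definition tensor_opp (x : tensor) : tensor :=
  \pi_tensor [seq (- p.1, p.2) | p <- repr x].

Lemma tensor_add_pi s t :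
  tensor_add (\pi_tensor s) (\pi_tensor t) = \pi_tensor (s ++ t).
Proof. by apply/tensor_eqP/tensor_rel_cat; apply: tensor_rel_repr. Qed.

Lemma tensor_addA : associative tensor_add.
Proof.
elim/quotW=> s; elim/quotW=> t; elim/quotW=> u.
by rewrite (tensor_add_pi t u) (tensor_add_pi s t) !tensor_add_pi catA.
Qed.

Lemma tensor_addC : commutative tensor_add.
Proof.
elim/quotW=> s; elim/quotW=> t; rewrite (tensor_add_pi s) (tensor_add_pi t).
exact/tensor_eqP/tensor_rel_catC.
Qed.

Lemma tensor_add0 : left_id tensor_zero tensor_add.
Proof. by elim/quotW=> s; rewrite (tensor_add_pi [::] s). Qed.

Lemma tensor_addN : left_inverse tensor_zero tensor_opp tensor_add.
Proof.
move=> x; rewrite -{2}[x]reprK (tensor_add_pi _ (repr x)); apply/tensor_eqP.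
elim: (repr x) => [|[m n] s IHs]; first exact: tensor_rel_refl.
set s' := [seq _ | _ <- s] in IHs.
change (tensor_rel ([:: (- m, n)] ++ (s' ++ ([:: (m, n)] ++ s))) [::]).
apply: (tensor_rel_trans (t := [:: (- m, n)] ++ ([:: (m, n)] ++ (s' ++ s)))).
  apply: tensor_rel_cat; first exact: tensor_rel_refl.
  rewrite !catA; apply: tensor_rel_cat; last exact: tensor_rel_refl.
  exact: tensor_rel_catC.
rewrite catA; apply: (tensor_rel_trans (t := [:: (- m, n); (m, n)] ++ [::])).
  by apply: tensor_rel_cat; first exact: tensor_rel_refl.
rewrite cats0; apply: (tensor_rel_trans (t := [:: (- m + m, n)])).
  exact/tensor_rel_sym/tensor_rel_Dl.
by rewrite addNr; apply: tensor_rel_0.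
Qed.

HB.instance Definition _ :=
  GRing.isZmodule.Build tensor tensor_addA tensor_addC tensor_add0 tensor_addN.

Lemma pi_tensor_cat s t : \pi_tensor (s ++ t) = \pi_tensor s + \pi_tensor t.
Proof. by rewrite [RHS]tensor_add_pi. Qed.

Lemma pi_tensor_nil : \pi_tensor [::] = 0.
Proof. by []. Qed.

Definition pure (m : M) (n : N) : tensor := \pi_tensor [:: (m, n)].

Lemma pureDl m m' n : pure (m + m') n = pure m n + pure m' n.
Proof. by rewrite -pi_tensor_cat; apply/tensor_eqP/tensor_rel_Dl. Qed.

Lemma pureDr m n n' : pure m (n + n') = pure m n + pure m n'.
Proof. by rewrite -pi_tensor_cat; apply/tensor_eqP/tensor_rel_Dr. Qed.

Lemma pureZ a m n : pure (a *: m) n = pure m (a *: n).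
Proof. exact/tensor_eqP/tensor_rel_Z. Qed.

Lemma tensorE (x : tensor) : x = \sum_(p <- repr x) pure p.1 p.2.
Proof.
rewrite -[LHS]reprK; elim: (repr x) => [|[m n] s IHs].
  by rewrite big_nil pi_tensor_nil.
by rewrite big_cons -IHs -cat1s pi_tensor_cat.
Qed.

Definition balanced (G : zmodType) (phi : M -> N -> G) : Prop :=
  [/\ forall m m' n, phi (m + m') n = phi m n + phi m' n,
      forall m n n', phi m (n + n') = phi m n + phi m n'
    & forall a m n, phi (a *: m) n = phi m (a *: n)].

Lemma pure_balanced : balanced pure.
Proof. by split; [apply: pureDl | apply: pureDr | apply: pureZ]. Qed.

(* The additive map induced by phi, meaningful when phi is balanced. *)
Definition tensor_lift (G : zmodType) (phi : M -> N -> G) (x : tensor) : G :=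
  tensor_sum phi (repr x).

Section Lift.
Variables (G : zmodType) (phi : M -> N -> G).
Hypothesis phiP : balanced phi.

Lemma tensor_sum_rel s t : tensor_rel s t -> tensor_sum phi s = tensor_sum phi t.
Proof.
have [Dl Dr Z] := phiP; rewrite /tensor_sum.
elim=> {s t}//=.
- by move=> s t u _ -> _ ->.
- by move=> s s' t t' _ IHs _ IHt; rewrite !big_cat /= IHs IHt.
- by move=> s t; rewrite !big_cat /= addrC.
- move=> n; rewrite big_seq1 big_nil /=.
  by apply: (addrI (phi 0 n)); rewrite -Dl !addr0.
- by move=> m m' n; rewrite !(big_cons, big_nil) /= ?addr0.
- by move=> m n n'; rewrite !(big_cons, big_nil) /= ?addr0.
- by move=> a m n; rewrite !(big_cons, big_nil) /= ?addr0.
Qed.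

Lemma tensor_lift_pi s : tensor_lift phi (\pi_tensor s) = tensor_sum phi s.
Proof. exact/tensor_sum_rel/tensor_rel_repr. Qed.

Lemma tensor_lift_pure m n : tensor_lift phi (pure m n) = phi m n.
Proof. by rewrite tensor_lift_pi /tensor_sum big_seq1. Qed.

Lemma tensor_liftD x y :
  tensor_lift phi (x + y) = tensor_lift phi x + tensor_lift phi y.
Proof.
rewrite -[x]reprK -[y]reprK.
by rewrite -pi_tensor_cat !tensor_lift_pi /tensor_sum big_cat.
Qed.

End Lift.

Lemma eq_tensor_lift (G : zmodType) (phi psi : M -> N -> G) :
  phi =2 psi -> tensor_lift phi =1 tensor_lift psi.
Proof. by move=> e x; apply: eq_bigr => p _; rewrite e. Qed.

Lemma tensor_ind (P : tensor -> Prop) :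
  P 0 -> (forall x y, P x -> P y -> P (x + y)) -> (forall m n, P (pure m n)) ->
  forall x, P x.
Proof.
move=> P0 PD Pp x; rewrite [x]tensorE.
by elim/big_ind: _ => // p _; apply: Pp.
Qed.

End TensorModule.

Arguments pure {A M N}.

Definition tensor_map (A : comPzRingType) (M N P : lmodType A) (u : N -> P) :
  tensor M N -> tensor M P := tensor_lift (fun m n => pure m (u n)).

Lemma tensor_map_balanced (A : comPzRingType) (M N P : lmodType A)
  (u : {linear N -> P}) : balanced (fun (m : M) n => pure m (u n)).
Proof.
split=> *; first exact: pureDl.
  by rewrite raddfD pureDr.
by rewrite linearZ pureZ.
Qed.

Definition flat_module (A : comPzRingType) (M : lmodType A) : Prop :=
  forall (N P : lmodType A) (u : {linear N -> P}),
    injective u -> injective (tensor_map (M := M) u).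

Definition restr (A B : comPzRingType) (f : {rmorphism A -> B}) : Type := B.

Section Restr.
Variables (A B : comPzRingType) (f : {rmorphism A -> B}).

HB.instance Definition _ := GRing.ComPzRing.on (restr f).

Definition restr_scale (a : A) (x : restr f) : restr f := (f a : restr f) * x.

Lemma restr_scaleA a b x :
  restr_scale a (restr_scale b x) = restr_scale (a * b) x.
Proof. by rewrite /restr_scale rmorphM mulrA. Qed.

Lemma restr_scale1 : left_id 1 restr_scale.
Proof. by move=> x; rewrite /restr_scale rmorph1 mul1r. Qed.

Lemma restr_scaleDr : right_distributive restr_scale +%R.
Proof. by move=> a x y; rewrite /restr_scale mulrDr. Qed.

Lemma restr_scaleDl x : {morph restr_scale^~ x : a b / a + b}.
Proof. by move=> a b; rewrite /restr_scale rmorphD mulrDl. Qed.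

HB.instance Definition _ := GRing.Zmodule_isLmodule.Build A (restr f)
  restr_scaleA restr_scale1 restr_scaleDr restr_scaleDl.

Lemma restr_scalerAl (a : A) (x y : restr f) : a *: (x * y) = (a *: x) * y.
Proof. exact: mulrA. Qed.

End Restr.

Definition flat (A B : comPzRingType) (f : {rmorphism A -> B}) : Prop :=
  flat_module (restr f).

Section TensorRing.
Variables (A B C : comPzRingType).
Variables (f : {rmorphism A -> B}) (g : {rmorphism A -> C}).

Definition tensor_ring := tensor (restr f) (restr g).

HB.instance Definition _ := GRing.Zmodule.on tensor_ring.

Local Notation T := tensor_ring.

Definition tpure (b : B) (c : C) : T := pure (b : restr f) (c : restr g).

Let mul1 (b : restr f) (c : restr g) (y : T) : T :=
  tensor_lift (fun b' c' => tpure (b * b') (c * c')) y.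

Definition tensor_mul (x y : T) : T := tensor_lift (fun b c => mul1 b c y) x.

Let bal1 (b : restr f) (c : restr g) :
  balanced (fun (b' : restr f) (c' : restr g) => tpure (b * b') (c * c')).
Proof.
split=> [b1 b2 c'|b' c1 c2|a b' c'].
- by rewrite mulrDr /tpure; apply: pureDl.
- by rewrite mulrDr /tpure; apply: pureDr.
- rewrite /tpure [b * _]mulrC -restr_scalerAl [c * (a *: _)]mulrC.
  by rewrite -restr_scalerAl [b' * b]mulrC [c' * c]mulrC; apply: pureZ.
Qed.

Let bal2 (y : T) : balanced (fun b c => mul1 b c y).
Proof.
have H0 b c : mul1 b c 0 = 0.
  by apply: (addrI (mul1 b c 0)); rewrite -(tensor_liftD (bal1 b c)) !addr0.
split=> *; move: y; apply: tensor_ind => *; rewrite ?H0 ?addr0 //.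
- rewrite /mul1 !(tensor_liftD (bal1 _ _)) addrACA; congr (_ + _) => //.
- by rewrite /mul1 !(tensor_lift_pure (bal1 _ _)) mulrDl; apply: pureDl.
- rewrite /mul1 !(tensor_liftD (bal1 _ _)) addrACA; congr (_ + _) => //.
- by rewrite /mul1 !(tensor_lift_pure (bal1 _ _)) mulrDl; apply: pureDr.
- rewrite /mul1 !(tensor_liftD (bal1 _ _)); congr (_ + _) => //.
- rewrite /mul1 !(tensor_lift_pure (bal1 _ _)) -!restr_scalerAl.
  exact: pureZ.
Qed.

Lemma tensor_mul_pure b c b' c' :
  tensor_mul (tpure b c) (tpure b' c') = tpure (b * b') (c * c').
Proof.
rewrite /tensor_mul /tpure (tensor_lift_pure (bal2 _)).
by rewrite /mul1 (tensor_lift_pure (bal1 _ _)).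
Qed.

Lemma tensor_mulDl : left_distributive tensor_mul +%R.
Proof. by move=> x y z; apply: (tensor_liftD (bal2 z)). Qed.

Lemma tensor_mulDr : right_distributive tensor_mul +%R.
Proof.
move=> x y z; rewrite /tensor_mul.
move: x; apply: tensor_ind => [|x x' Hx Hx'|b c].
- have H0 w : tensor_lift (fun b c => mul1 b c w) 0 = 0.
    by apply: (addrI (tensor_lift (fun b c => mul1 b c w) 0));
      rewrite -(tensor_liftD (bal2 w)) !addr0.
  by rewrite !H0 addr0.
- by rewrite !(tensor_liftD (bal2 _)) Hx Hx' addrACA.
- rewrite !(tensor_lift_pure (bal2 _)).
  by rewrite /mul1 (tensor_liftD (bal1 _ _)).
Qed.

Let mul0 : left_zero 0 tensor_mul.
Proof.
by move=> x; apply: (addrI (tensor_mul 0 x)); rewrite -tensor_mulDl !addr0.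
Qed.

Let mulr0' : right_zero 0 tensor_mul.
Proof.
by move=> x; apply: (addrI (tensor_mul x 0)); rewrite -tensor_mulDr !addr0.
Qed.

Lemma tensor_mulC : commutative tensor_mul.
Proof.
move=> x y; move: x; apply: tensor_ind => [|x x' Hx Hx'|b c].
- by rewrite mul0 mulr0'.
- by rewrite tensor_mulDl tensor_mulDr Hx Hx'.
move: y; apply: tensor_ind => [|y y' Hy Hy'|b' c'].
- by rewrite mul0 mulr0'.
- by rewrite tensor_mulDl tensor_mulDr Hy Hy'.
by rewrite !tensor_mul_pure mulrC [c * _]mulrC.
Qed.

Lemma tensor_mulA : associative tensor_mul.
Proof.
move=> x y z; move: x; apply: tensor_ind => [|x x' Hx Hx'|b c].
- by rewrite !mul0.
- by rewrite !tensor_mulDl Hx Hx'.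
move: y; apply: tensor_ind => [|y y' Hy Hy'|b' c'].
- by rewrite mul0 mulr0' mul0.
- by rewrite tensor_mulDl !tensor_mulDr Hy Hy' tensor_mulDl.
move: z; apply: tensor_ind => [|z z' Hz Hz'|b'' c''].
- by rewrite !mulr0'.
- by rewrite !tensor_mulDr Hz Hz'.
by rewrite !tensor_mul_pure !mulrA.
Qed.

Lemma tensor_mul1 : left_id (tpure 1 1) tensor_mul.
Proof.
move=> x; move: x; apply: tensor_ind => [|x x' Hx Hx'|b c].
- by rewrite mulr0'.
- by rewrite tensor_mulDr Hx Hx'.
by rewrite tensor_mul_pure !mul1r.
Qed.

HB.instance Definition _ := GRing.Zmodule_isComPzRing.Build tensor_ring
  tensor_mulA tensor_mulC tensor_mul1 tensor_mulDl.

Lemma tpureM b c b' c' : tpure b c * tpure b' c' = tpure (b * b') (c * c').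
Proof. exact: tensor_mul_pure. Qed.

Definition tensor_inr (c : C) : T := tpure 1 c.

Lemma tensor_inr_zmod : zmod_morphism tensor_inr.
Proof.
move=> c c'; apply: (addIr (tensor_inr c')); rewrite subrK.
by rewrite -[LHS]pureDr subrK.
Qed.

Lemma tensor_inr_monoid : monoid_morphism tensor_inr.
Proof. by split=> // c c'; rewrite tpureM mulr1. Qed.

HB.instance Definition _ :=
  GRing.isZmodMorphism.Build C tensor_ring tensor_inr tensor_inr_zmod.
HB.instance Definition _ :=
  GRing.isMonoidMorphism.Build C tensor_ring tensor_inr tensor_inr_monoid.

End TensorRing.

Definition iso_under (A B B' : comPzRingType)
    (f : {rmorphism A -> B}) (f' : {rmorphism A -> B'}) : Prop :=
  exists h : {rmorphism B -> B'}, bijective h /\ forall a, h (f a) = f' a.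

Section Subalgebras.
Variables (k : comNzRingType) (A : comAlgType k).

Definition subalg_sort (S : subalgClosed A) : Type := {x : A | x \in S}.

HB.instance Definition _ (S : subalgClosed A) := SubChoice.on (subalg_sort S).
HB.instance Definition _ (S : subalgClosed A) :=
  [SubChoice_isSubAlgebra of subalg_sort S by <:].
HB.instance Definition _ (S : subalgClosed A) :=
  [SubNzRing_isSubComNzRing of subalg_sort S by <:].

Definition gen_subalg (G : A -> Prop) : {pred A} := fun x =>
  `[< forall S : subalgClosed A, (forall g, G g -> g \in S) -> x \in S >].

Lemma gen_subalgP (G : A -> Prop) (x : A) :
  reflect (forall S : subalgClosed A, (forall g, G g -> g \in S) -> x \in S)
    (x \in gen_subalg G).
Proof. exact: asboolP. Qed.

Section GenClosed.
Variable G : A -> Prop.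

Lemma gen_subalg_subsemialg : GRing.subsemialg_closed (gen_subalg G).
Proof.
split.
- by apply/gen_subalgP => S _; apply: rpred1.
- split; first by apply/gen_subalgP => S _; apply: rpred0.
  move=> x y /gen_subalgP Hx /gen_subalgP Hy; apply/gen_subalgP => S GS.
  by apply: rpredD; [apply: Hx | apply: Hy].
- move=> a x /gen_subalgP Hx; apply/gen_subalgP => S GS.
  by apply: rpredZ; apply: Hx.
- move=> x y /gen_subalgP Hx /gen_subalgP Hy; apply/gen_subalgP => S GS.
  by apply: rpredM; [apply: Hx | apply: Hy].
Qed.

HB.instance Definition _ := GRing.isSubalgClosed.Build k A (gen_subalg G)
  gen_subalg_subsemialg.

Lemma mem_gen_subalg g : G g -> g \in gen_subalg G.
Proof. by move=> Gg; apply/gen_subalgP => S; apply. Qed.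

End GenClosed.

End Subalgebras.

Notation ratfun F := {fraction {poly F}}.

Section RationalFunctions.
Variable F : fieldType.

Local Notation K := (ratfun F).
Local Notation ratpoly := (@FracField.tofrac {poly F}).

Definition tvar : K := ratpoly 'X.

(* The rational function x is defined at t = 0, with value c. *)
Definition at0_is (x : K) (c : F) : Prop :=
  exists p q : {poly F},
    [/\ q.[0] != 0, x = ratpoly p / ratpoly q & c = p.[0] / q.[0]].

Definition defined_at0 (x : K) : Prop := exists c, at0_is x c.

(* Arbitrary (equal to 0) when x is not defined at t = 0. *)
Definition at0 (x : K) : F :=
  if pselect (defined_at0 x) is left h then sval (cid h) else 0.

Definition is_val (x : K) (w : int) : Prop :=
  defined_at0 (tvar ^ (- w) * x) /\ at0 (tvar ^ (- w) * x) != 0.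

(* Arbitrary (equal to 0) at x = 0. *)
Definition tval (x : K) : int :=
  if pselect (exists w, is_val x w) is left h then sval (cid h) else 0.

Lemma ratpoly_eq0 p : (ratpoly p == 0) = (p == 0).
Proof. exact: tofrac_eq0. Qed.

Lemma nz_horner (q : {poly F}) : q.[0] != 0 -> ratpoly q != 0.
Proof.
by apply: contraNneq => /eqP; rewrite ratpoly_eq0 => /eqP ->; rewrite horner0.
Qed.

Lemma tvar_neq0 : tvar != 0.
Proof. by rewrite ratpoly_eq0 polyX_eq0. Qed.

Lemma at0_is_uniq x c c' : at0_is x c -> at0_is x c' -> c = c'.
Proof.
move=> [p [q [q0 -> ->]]] [p' [q' [q'0 e ->]]].
move/eqP: e; rewrite eqr_div ?nz_horner // -!rmorphM /=.
rewrite /ratpoly tofrac_eq => /eqP /(congr1 (fun r => r.[0])).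
by rewrite !hornerM => e; apply/eqP; rewrite eqr_div ?e.
Qed.

Lemma at0P x c : at0_is x c -> at0 x = c.
Proof.
move=> xc; rewrite /at0; case: pselect => [h|[]]; last by exists c.
by case: cid => c' /= /at0_is_uniq; apply.
Qed.

Lemma at0E x : defined_at0 x -> at0_is x (at0 x).
Proof. by case=> c xc; rewrite (at0P xc). Qed.

Lemma at0_is0 : at0_is 0 0.
Proof.
by exists 0, 1; rewrite hornerC oner_neq0 rmorph0 rmorph1 mul0r horner0 mul0r.
Qed.

Lemma at0_is1 : at0_is 1 1.
Proof. by exists 1, 1; rewrite hornerC oner_neq0 !divr1 rmorph1. Qed.

Lemma at0_isB x y c d : at0_is x c -> at0_is y d -> at0_is (x - y) (c - d).
Proof.
move=> [p [q [q0 -> ->]]] [p' [q' [q'0 -> ->]]].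
exists (p * q' - p' * q), (q * q'); rewrite hornerM mulf_neq0 //; split=> //.
  by rewrite -mulNr addf_div ?nz_horner // rmorphB !rmorphM /= mulNr.
by rewrite -mulNr addf_div // hornerD hornerN !hornerM mulNr.
Qed.

Lemma at0_isM x y c d : at0_is x c -> at0_is y d -> at0_is (x * y) (c * d).
Proof.
move=> [p [q [q0 -> ->]]] [p' [q' [q'0 -> ->]]].
exists (p * p'), (q * q'); rewrite hornerM mulf_neq0 //; split=> //.
  by rewrite !rmorphM /= mulf_div.
by rewrite hornerM mulf_div.
Qed.

Lemma at0_isV x c : at0_is x c -> c != 0 -> at0_is x^-1 c^-1.
Proof.
move=> [p [q [q0 -> ->]]] c0; exists q, p; rewrite !invf_div; split=> //.
by apply: contraNneq c0 => ->; rewrite mul0r.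
Qed.

Lemma at0_isX n : at0_is (tvar ^+ n) (n == 0)%:R.
Proof.
exists 'X^n, 1; rewrite hornerC oner_neq0 hornerXn expr0n /= rmorphXn rmorph1.
by rewrite !divr1.
Qed.

Lemma at0_isXz_inj (x : K) (a b : int) (c d : F) : c != 0 -> d != 0 ->
  at0_is (tvar ^ a * x) c -> at0_is (tvar ^ b * x) d -> a = b.
Proof.
wlog lab : a b c d / (a <= b)%R => [H|] c0 d0 Ha Hb.
  have [le|/ltW le] := leP a b; first exact: (H a b c d).
  by apply/esym; apply: (H b a d c).
have := at0_isM Hb (at0_isV Ha c0).
have x0 : x != 0.
  apply: contraNneq c0 => x0; rewrite x0 mulr0 in Ha.
  by rewrite (at0_is_uniq Ha at0_is0).
rewrite invfM mulrACA divff // mulr1 invr_expz -expfzDr ?tvar_neq0 //.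
have -> : b - a = `|b - a|%N by rewrite gez0_abs // subr_ge0.
move=> /at0_is_uniq /(_ (at0_isX _)).
case: eqP => [/eqP|_ /eqP].
  by rewrite absz_eq0 subr_eq0 => /eqP.
by rewrite mulf_eq0 invr_eq0 (negPf c0) (negPf d0).
Qed.

Lemma is_val_uniq x w w' : is_val x w -> is_val x w' -> w = w'.
Proof.
move=> [/at0E D n] [/at0E D' n'].
by apply: oppr_inj; apply: at0_isXz_inj n n' D D'.
Qed.

Lemma tvalP x w : is_val x w -> tval x = w.
Proof.
move=> xw; rewrite /tval; case: pselect => [h|[]]; last by exists w.
by case: cid => w' /= /is_val_uniq; apply.
Qed.

Lemma poly_split0 (p : {poly F}) : p != 0 ->
  exists n (r : {poly F}), r.[0] != 0 /\ p = r * 'X^n.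
Proof.
move=> p0; have [m [r nr ->]] := multiplicity_XsubC p 0.
by rewrite p0 /= in nr; exists m, r; rewrite subr0.
Qed.

Lemma ratfun_ratio (x : K) : exists p q, q != 0 /\ x = ratpoly p / ratpoly q.
Proof.
elim/quotW: x => y; exists \n_y, \d_y; split; first exact: denom_ratioP.
apply: (mulIf (x := ratpoly \d_y)); first by rewrite ratpoly_eq0 denom_ratioP.
rewrite divfK ?ratpoly_eq0 ?denom_ratioP //.
unlock FracField.tofrac.
rewrite -[LHS]FracField.pi_mul; apply/eqmodP; rewrite /= FracField.equivfE.
rewrite /FracField.mulf !numden_Ratio ?mulr1 ?denom_ratioP ?oner_neq0 //.
by rewrite mulrC.
Qed.

Lemma div_cancel (L : fieldType) (a b r s : L) : a != 0 -> b != 0 ->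
  a / b * (r * b / (s * a)) = r / s.
Proof.
move=> a0 b0; rewrite mulf_div mulrCA [b * _]mulrCA [b * a]mulrC -mulf_div.
by rewrite divff ?mulr1 // mulf_neq0.
Qed.

Lemma is_val_tval x : x != 0 -> is_val x (tval x).
Proof.
have [p [q [q0 ->]]] := ratfun_ratio x => pq0.
have p0 : p != 0.
  by apply: contraNneq pq0 => ->; rewrite rmorph0 mul0r.
have [m [r [r0 ep]]] := poly_split0 p0; have [n [s [s0 eq]]] := poly_split0 q0.
suff H : is_val (ratpoly p / ratpoly q) (m%:Z - n%:Z) by rewrite (tvalP H).
have E : tvar ^ (- (m%:Z - n%:Z)) * (ratpoly p / ratpoly q) =
         ratpoly r / ratpoly s.
  rewrite opprB expfzDr ?tvar_neq0 // -invr_expz -!exprnP.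
  rewrite ep eq !tofracM !tofracXn -/tvar.
  apply: div_cancel; apply: expf_neq0; exact: tvar_neq0.
have H : at0_is (ratpoly r / ratpoly s) (r.[0] / s.[0]) by exists r, s.
rewrite /is_val E; split; first by exists (r.[0] / s.[0]).
by rewrite (at0P H) mulf_neq0 ?invr_neq0.
Qed.

Lemma defined_at0_val x : defined_at0 x <-> x = 0 \/ 0 <= tval x.
Proof.
have [->|x0] := eqVneq x 0.
  by split=> [|_]; [left | exists 0; apply: at0_is0].
have [/at0E D n0] := is_val_tval x0.
split=> [/at0E D'|[e|le]]; last 2 first.
- by rewrite e eqxx in x0.
- have -> : x = tvar ^+ `|tval x|%N * (tvar ^ (- tval x) * x).
    rewrite mulrA exprnP gez0_abs // -expfzDr ?tvar_neq0 // subrr.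
    by rewrite expr0z mul1r.
  by eexists; apply: at0_isM (at0_isX _) D.
right; rewrite leNgt; apply/negP => lt.
have := at0_isM (at0_isX `|tval x|%N) D'.
rewrite exprnP ltz0_abs // => /(at0_is_uniq D) e.
by move: n0; rewrite e absz_eq0 lt_eqF // mul0r eqxx.
Qed.

Definition valring_pred : {pred K} := fun x => (x == 0) || (0 <= tval x).

Lemma valring_predP x : reflect (defined_at0 x) (x \in valring_pred).
Proof.
apply: (iffP idP) => [/orP H|/defined_at0_val H]; last first.
  by apply/orP; case: H => [->|->]; [left|right].
by apply/defined_at0_val; case: H => [/eqP ->|]; [left|right].
Qed.

Lemma valring_subring : subring_closed valring_pred.
Proof.
split=> [|x y /valring_predP[c Hx] /valring_predP[d Hy]
         |x y /valring_predP[c Hx] /valring_predP[d Hy]]; apply/valring_predP.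
- by exists 1; apply: at0_is1.
- by exists (c - d); apply: at0_isB.
- by exists (c * d); apply: at0_isM.
Qed.

HB.instance Definition _ := GRing.isSubringClosed.Build K valring_pred
  valring_subring.

Definition valring : Type := {x : K | x \in valring_pred}.
HB.instance Definition _ := SubChoice.on valring.
HB.instance Definition _ := [SubChoice_isSubComNzRing of valring by <:].

Definition valring_incl (x : valring) : K := val x.

Lemma valring_incl_zmod : zmod_morphism valring_incl.
Proof. by []. Qed.

Lemma valring_incl_monoid : monoid_morphism valring_incl.
Proof. by []. Qed.

HB.instance Definition _ :=
  GRing.isZmodMorphism.Build valring K valring_incl valring_incl_zmod.
HB.instance Definition _ :=
  GRing.isMonoidMorphism.Build valring K valring_incl valring_incl_monoid.

Definition maxideal : {pred valring} :=
  fun x => (val x == 0) || (0 < tval (val x)).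

Lemma maxidealP x : (x \in maxideal) = (at0 (val x) == 0).
Proof.
rewrite unfold_in /maxideal; have := valP x; set y := val x => /valring_predP Hy.
have [->|y0] /= := eqVneq y 0; first by rewrite (at0P at0_is0) eqxx.
have [/at0E D n0] := is_val_tval y0.
have := at0E Hy; have /defined_at0_val[/eqP|] := Hy; first by rewrite (negPf y0).
rewrite le_eqVlt => /orP[/eqP e|lt] H.
  by rewrite -e ltxx; rewrite -e oppr0 expr0z mul1r in n0; rewrite (negPf n0).
rewrite lt; apply/esym/eqP.
have -> : y = tvar ^+ `|tval y|%N * (tvar ^ (- tval y) * y).
  rewrite mulrA exprnP gtz0_abs // -expfzDr ?tvar_neq0 // subrr.
  by rewrite expr0z mul1r.
by rewrite (at0P (at0_isM (at0_isX _) D)) absz_eq0 gt_eqF // mul0r.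
Qed.

Lemma maxideal_idealr : idealr_closed maxideal.
Proof.
split; rewrite ?maxidealP ?rmorph0 ?(at0P at0_is0) //.
  by rewrite rmorph1 (at0P at0_is1) oner_eq0.
move=> a x y; rewrite !maxidealP => /eqP x0 /eqP y0.
have := at0E (valring_predP _ (valP x)); have := at0E (valring_predP _ (valP y)).
rewrite /= x0 y0 => Hy Hx; have Ha := at0E (valring_predP _ (valP a)).
have := at0_isB (at0_isM Ha Hx) (at0_isM (at0_isB at0_is0 at0_is1) Hy).
rewrite !mulr0 subr0 sub0r mulN1r opprK => H.
by rewrite (at0P H).
Qed.

HB.instance Definition _ := isIdealr.Build valring maxideal maxideal_idealr.

Definition residue_ring := {ideal_quot maxideal}.
HB.instance Definition _ := GRing.ComNzRing.on residue_ring.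

Definition residue (x : valring) : residue_ring := \pi_residue_ring x.

Lemma residue_zmod : zmod_morphism residue.
Proof. exact: (rmorphB (\pi_{ideal_quot maxideal})). Qed.

Lemma residue_monoid : monoid_morphism residue.
Proof.
split; first exact: (rmorph1 (\pi_{ideal_quot maxideal})).
exact: (rmorphM (\pi_{ideal_quot maxideal})).
Qed.

HB.instance Definition _ :=
  GRing.isZmodMorphism.Build valring residue_ring residue residue_zmod.
HB.instance Definition _ :=
  GRing.isMonoidMorphism.Build valring residue_ring residue residue_monoid.

(* The residue field is F, through evaluation at t = 0. *)
Lemma residue_eq (x y : valring) :
  residue x = residue y <-> at0 (val x) = at0 (val y).
Proof.
have E : (residue x == residue y) = (x - y \in maxideal).
  by rewrite Quotient.idealrBE.
have Hx := at0E (valring_predP _ (valP x)).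
have Hy := at0E (valring_predP _ (valP y)).
rewrite maxidealP (at0P (at0_isB Hx Hy)) subr_eq0 in E.
by split=> [/eqP|/eqP]; [rewrite E => /eqP | rewrite -E => /eqP].
Qed.

Lemma at0_surj (c : F) : exists x : valring, at0 (val x) = c.
Proof.
have H : at0_is (ratpoly c%:P) c.
  by exists c%:P, 1; rewrite !hornerC oner_neq0 rmorph1 !divr1.
have D : ratpoly c%:P \in valring_pred by apply/valring_predP; exists c.
by exists (exist (fun x => x \in valring_pred) _ D); apply: at0P H.
Qed.

End RationalFunctions.

Section Khovanskii.
Variables (F : fieldType) (n : nat).

Local Notation K := (ratfun F).

(* Only meaningful for f != 0: the starting value of the minimum is the
   valuation of one of the nonzero coefficients of f. *)
Definition trop (f : {mpoly K[n]}) : int :=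
  \big[Order.min/tval (mleadc f)]_(m <- msupp f) tval f@_m.

Definition normalize (f : {mpoly K[n]}) : {mpoly K[n]} :=
  tvar F ^ (- trop f) *: f.

Definition initial_form (f : {mpoly K[n]}) : {mpoly F[n]} :=
  map_mpoly (@at0 F) (normalize f).

Definition initial_algebra (U : subalgClosed {mpoly K[n]}) : {pred {mpoly F[n]}} :=
  gen_subalg (fun g => exists f, [/\ f \in U, f != 0 & g = initial_form f]).

Definition is_monomial (g : {mpoly F[n]}) : Prop :=
  exists (c : F) (m : 'X_{1..n}), c != 0 /\ g = c *: 'X_[m].

Definition khovanskii_basis (U : subalgClosed {mpoly K[n]})
    (B : {mpoly K[n]} -> Prop) : Prop :=
  (forall f, B f -> [/\ f \in U, f != 0 & is_monomial (initial_form f)]) /\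
  initial_algebra U =i
    gen_subalg (fun g => exists f, B f /\ g = initial_form f).

(* The generators are the polynomials t ^ (- trop f) f with f in R nonzero,
   as elements of the polynomial ring over the valuation ring. *)
Definition model_pred (R : subalgClosed {mpoly K[n]}) :
    {pred {mpoly (valring F)[n]}} :=
  gen_subalg (fun g => exists f,
    [/\ f \in R, f != 0 & map_mpoly (@valring_incl F) g = normalize f]).
HB.instance Definition _ R := GRing.SubalgClosed.on (model_pred R).

Definition model (R : subalgClosed {mpoly K[n]}) : Type :=
  subalg_sort (model_pred R).
HB.instance Definition _ R := GRing.ComAlgebra.on (model R).

End Khovanskii.

Section MonoidAlgebra.
Variables (k : comNzRingType) (S : nmodType).

Definition monoid_alg : Type := {freeg S / k}.

HB.instance Definition _ := GRing.Lmodule.on monoid_alg.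

Definition chi (c : k) (s : S) : monoid_alg := << c *g s >>.

Definition monoid_alg_mul (f g : monoid_alg) : monoid_alg :=
  \sum_(s <- dom f) \sum_(t <- dom g) chi (coeff s f * coeff t g) (s + t).

Lemma chiD a b s : chi (a + b) s = chi a s + chi b s.
Proof. by rewrite /chi freegUD. Qed.

Lemma chi0 s : chi 0 s = 0.
Proof. exact: freegU0. Qed.

Lemma chiE (f : monoid_alg) : f = \sum_(s <- dom f) chi (coeff s f) s.
Proof. by rewrite -[LHS]freeg_sumE. Qed.

Lemma chi_ind (P : monoid_alg -> Prop) :
  P 0 -> (forall f g, P f -> P g -> P (f + g)) -> (forall c s, P (chi c s)) ->
  forall f, P f.
Proof. by move=> P0 PD Pc f; rewrite [f]chiE; elim/big_ind: _. Qed.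

Lemma dom_widen (V : nmodType) (G : k -> S -> V) (f : monoid_alg) (d : seq S) :
  (forall s, G 0 s = 0) -> uniq d -> {subset dom f <= d} ->
  \sum_(s <- dom f) G (coeff s f) s = \sum_(s <- d) G (coeff s f) s.
Proof.
move=> G0 ud sd; rewrite [RHS](bigID (mem (dom f))) /= [X in _ = _ + X]big1.
  rewrite addr0 -[RHS]big_filter; apply: perm_big; apply: uniq_perm.
  - exact: uniq_dom.
  - exact: filter_uniq.
  move=> s; rewrite mem_filter; case H: (s \in dom f) => //=.
  by rewrite sd.
by move=> s H; rewrite coeff_outdom.
Qed.

Lemma monoid_alg_mulE (f g : monoid_alg) (d e : seq S) :
  uniq d -> {subset dom f <= d} -> uniq e -> {subset dom g <= e} ->
  monoid_alg_mul f g =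
  \sum_(s <- d) \sum_(t <- e) chi (coeff s f * coeff t g) (s + t).
Proof.
move=> ud sd ue se; rewrite /monoid_alg_mul.
rewrite (dom_widen (G := fun a s => \sum_(t <- dom g) chi (a * coeff t g) (s + t))
  _ ud sd).
  apply: eq_bigr => s _.
  rewrite (dom_widen (G := fun b t => chi (coeff s f * b) (s + t)) _ ue se) //.
  by move=> t; rewrite mulr0 chi0.
by move=> s; rewrite big1 // => t _; rewrite mul0r chi0.
Qed.

Lemma chiM a b s t :
  monoid_alg_mul (chi a s) (chi b t) = chi (a * b) (s + t).
Proof.
have sub c u : {subset dom (chi c u) <= [:: u]}.
  move=> v; rewrite mem_dom /chi coeffU inE [v == u]eq_sym.
  by case: (u == v) => //; rewrite mulr0 eqxx.
rewrite (monoid_alg_mulE (d := [:: s]) (e := [:: t])) //.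
by rewrite !big_seq1 /chi !coeffU !eqxx !mulr1.
Qed.

Lemma monoid_alg_mulC : commutative monoid_alg_mul.
Proof.
move=> f g; rewrite /monoid_alg_mul exchange_big; apply: eq_bigr => t _.
by apply: eq_bigr => s _; rewrite mulrC addrC.
Qed.

Lemma monoid_alg_mulDl : left_distributive monoid_alg_mul +%R.
Proof.
move=> f g h; pose d := undup (dom f ++ dom g ++ dom (f + g)).
have ud : uniq d by apply: undup_uniq.
have s1 : {subset dom f <= d} by move=> x; rewrite mem_undup !mem_cat => ->.
have s2 : {subset dom g <= d}.
  by move=> x; rewrite mem_undup !mem_cat => ->; rewrite orbT.
have s3 : {subset dom (f + g) <= d}.
  by move=> x; rewrite mem_undup !mem_cat => ->; rewrite !orbT.
have uh := uniq_dom h; have sh : {subset dom h <= dom h} by [].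
rewrite !(monoid_alg_mulE ud _ uh sh) // -big_split; apply: eq_bigr => s _ /=.
rewrite -big_split; apply: eq_bigr => t _ /=.
by rewrite coeffD mulrDl chiD.
Qed.

Let monoid_alg_mulDr : right_distributive monoid_alg_mul +%R.
Proof. by move=> f g h; rewrite !(monoid_alg_mulC f) monoid_alg_mulDl. Qed.

Let monoid_alg_mul0 : left_zero 0 monoid_alg_mul.
Proof. by move=> f; rewrite /monoid_alg_mul dom0 big_nil. Qed.

Let monoid_alg_mulr0 : right_zero 0 monoid_alg_mul.
Proof. by move=> f; rewrite monoid_alg_mulC monoid_alg_mul0. Qed.

Lemma monoid_alg_mulA : associative monoid_alg_mul.
Proof.
move=> f g h; move: f; apply: chi_ind => [|f f' Hf Hf'|a s].
- by rewrite !monoid_alg_mul0.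
- by rewrite !monoid_alg_mulDl Hf Hf'.
move: g; apply: chi_ind => [|g g' Hg Hg'|b t].
- by rewrite monoid_alg_mul0 monoid_alg_mulr0 monoid_alg_mul0.
- by rewrite monoid_alg_mulDl !monoid_alg_mulDr Hg Hg' monoid_alg_mulDl.
move: h; apply: chi_ind => [|h h' Hh Hh'|c u].
- by rewrite !monoid_alg_mulr0.
- by rewrite !monoid_alg_mulDr Hh Hh'.
by rewrite !chiM mulrA addrA.
Qed.

Lemma monoid_alg_mul1 : left_id (chi 1 0) monoid_alg_mul.
Proof.
apply: chi_ind => [|f f' Hf Hf'|a s].
- by rewrite monoid_alg_mulr0.
- by rewrite monoid_alg_mulDr Hf Hf'.
by rewrite chiM mul1r add0r.
Qed.

Lemma monoid_alg_oner_neq0 : chi 1 0 != 0.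
Proof. by rewrite freegU_eq0 oner_neq0. Qed.

HB.instance Definition _ := GRing.Zmodule_isComNzRing.Build monoid_alg
  monoid_alg_mulA monoid_alg_mulC monoid_alg_mul1 monoid_alg_mulDl
  monoid_alg_oner_neq0.

Lemma chiZ c a s : c *: chi a s = chi (c * a) s.
Proof. by apply/eqP/freeg_eqP => t; rewrite coeffZ /chi !coeffU mulrA. Qed.

Lemma monoid_alg_scaleAl c (f g : monoid_alg) : c *: (f * g) = (c *: f) * g.
Proof.
move: f; apply: chi_ind => [|f f' Hf Hf'|a s].
- by rewrite scaler0 mul0r scaler0.
- by rewrite scalerDr !mulrDl scalerDr Hf Hf'.
move: g; apply: chi_ind => [|g g' Hg Hg'|b t].
- by rewrite !mulr0 scaler0.
- by rewrite !mulrDr scalerDr Hg Hg'.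
have E x y : chi x s * chi y t = chi (x * y) (s + t) := chiM x y s t.
by rewrite chiZ !E chiZ mulrA.
Qed.

HB.instance Definition _ :=
  GRing.Lmodule_isLalgebra.Build k monoid_alg monoid_alg_scaleAl.
HB.instance Definition _ := GRing.Lalgebra_isComAlgebra.Build k monoid_alg.

End MonoidAlgebra.

(* A finitely generated commutative monoid that embeds in a lattice. Affine toric
   varieties need not be normal, so saturation is not required. *)
Definition affine_semigroup (S : nmodType) : Prop :=
  (exists g : seq S, forall s, exists c : nat -> nat,
     s = \sum_(i < size g) g`_i *+ c i) /\
  (exists (d : nat) (e : {additive S -> 'rV[int]_d}), injective e).

Definition affine_toric (k : comNzRingType) (A : comPzRingType)
    (f : {rmorphism k -> A}) : Prop :=
  exists S : nmodType,
    affine_semigroup S /\ iso_under f (GRing.in_alg (monoid_alg k S)).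

(* Main.v *)
From HB Require Import structures.
Require Import Defs.
From mathcomp Require Import all_boot all_order all_algebra.
From mathcomp Require Import fraction.
From mathcomp Require Import boolp.
From mathcomp Require Import freeg mpoly.

Set Implicit Arguments.
Unset Strict Implicit.
Unset Printing Implicit Defensive.

Import Order.TTheory GRing.Theory Num.Theory.
Local Open Scope ring_scope.

(** Write K = F(t), O for its valuation ring and M for the O-algebra attached
    to R. Every nonzero f is t^w times its normalization, with w >= 0 when the
    coefficients of f lie in O. Hence M consists of the polynomials over O that
    lie in R ([mem_model]), and it is saturated: an element of M divisible by t
    in O[x] is divisible by t in M ([model_saturated]).

    Flatness. An element m of M is a multiple of its normalization e, some
    coefficient of which is a unit u of O; so m = phi(m) e, where phi is the
    corresponding coefficient function divided by u. Flatness follows from the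
    existence of these linear forms alone ([flat_of_functionals]), without
    choosing bases of finitely generated submodules.

    Generic fibre. As K is O localized at t, the elements of M (x) K are pure
    tensors with denominators t^N; so M (x) K embeds in K[x], with image R
    because every f in R is a power of t times an element of M.

    Special fibre. Evaluating coefficients at t = 0 maps M to F[x], with image
    the initial algebra of R ([reduction_image]) and, by saturation, kernel tM.
    The Khovanskii basis shows that the initial algebra is generated by
    finitely many monomials; it is therefore spanned by the monomials whose
    exponents lie in the finitely generated monoid S of their exponents
    ([monomial_algebraP]), that is, it is the algebra of S. The monoid S sits
    in Z^n, so this is an affine toric variety. *)

(* The bare name is taken by the projection from tuples to sequences. *)
Local Notation tval := Defs.tval.

(** * A criterion for flatness *)

Section Flat.
Variables (A : comPzRingType) (M : lmodType A).

Lemma pure0l (N : lmodType A) (x : N) : pure (0 : M) x = 0.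
Proof. by apply: (addrI (pure (0 : M) x)); rewrite -pureDl !addr0. Qed.

Lemma pure0r (N : lmodType A) (m : M) : pure m (0 : N) = 0.
Proof. by apply: (addrI (pure m (0 : N))); rewrite -pureDr !addr0. Qed.

Lemma pure_sumr (N : lmodType A) (I : Type) (s : seq I) (m : M) (f : I -> N) :
  pure m (\sum_(i <- s) f i) = \sum_(i <- s) pure m (f i).
Proof. exact: (big_morph _ (pureDr m) (pure0r N m)). Qed.

Lemma tensor_lift_sum (N : lmodType A) (G : zmodType) (phi : M -> N -> G)
    (I : Type) (s : seq I) (f : I -> M) (g : I -> N) : balanced phi ->
  tensor_lift phi (\sum_(i <- s) pure (f i) (g i)) =
  \sum_(i <- s) phi (f i) (g i).
Proof.
move=> phiP; elim: s => [|i s IHs].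
  rewrite !big_nil; apply: (addrI (tensor_lift phi 0)).
  by rewrite -tensor_liftD // !addr0.
by rewrite !big_cons tensor_liftD // tensor_lift_pure // IHs.
Qed.

(** A module in which every element m is phi m times some element e, for a
    linear form phi, is flat: tensoring phi with the identity extracts the
    coefficient of e from a tensor. *)
Lemma flat_of_functionals :
  (forall m : M, exists (e : M) (phi : {linear M -> A^o}), m = phi m *: e) ->
  flat_module M.
Proof.
move=> dual N P u u_inj.
have bal := tensor_map_balanced M u.
suff ker0 (s : seq (M * N)) : \sum_(p <- s) pure p.1 (u p.2) = 0 ->
    \sum_(p <- s) pure p.1 p.2 = 0.
  move=> x y exy; apply/eqP; rewrite -subr_eq0; apply/eqP.
  rewrite [x - y]tensorE; apply: ker0.
  rewrite -(tensor_lift_sum _ _ _ bal) -tensorE.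
  apply: (addIr (tensor_map u y)); rewrite add0r.
  by rewrite -(tensor_liftD bal) subrK.
(* Split every m_i as phi(m_i) e + (m_i - phi(m_i) e), for the e and phi of the
   first one, whose second part is zero. The coefficient of e in the sum
   vanishes because its image in P does, so that a shorter sum remains. *)
have [l] := ubnP (size s); elim: l s => // l IHl [|[m x] s] /=.
  by rewrite !big_nil.
rewrite ltnS => sl.
have [e [phi em]] := dual m.
have key (Q : lmodType A) (y : M * N -> Q) :
    \sum_(p <- (m, x) :: s) pure p.1 (y p) =
    pure e (\sum_(p <- (m, x) :: s) phi p.1 *: y p) +
    \sum_(p <- s) pure (p.1 - phi p.1 *: e) (y p).
  rewrite !big_cons pureDr -pureZ -em -addrA; congr (_ + _).
  rewrite pure_sumr -big_split; apply: eq_bigr => p _ /=.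
  by rewrite -pureZ -pureDl addrC subrK.
move=> z0.
have phix0 : \sum_(p <- (m, x) :: s) phi p.1 *: p.2 = 0.
  apply: u_inj; rewrite linear0 linear_sum.
  have phibal : balanced (fun (m : M) (y : P) => phi m *: y).
    split=> [a b y|a y y'|a b y].
    - by rewrite linearD scalerDl.
    - by rewrite scalerDr.
    - by rewrite linearZ /= -[a *: phi b]/(a * phi b) mulrC -scalerA.
  have lift0 : tensor_lift (fun (m : M) (y : P) => phi m *: y) 0 = 0.
    have := tensor_lift_sum (Nil nat) (fun=> 0 : M) (fun=> 0 : P) phibal.
    by rewrite !big_nil.
  rewrite -[RHS]lift0 -z0 (tensor_lift_sum _ _ _ phibal).
  by apply: eq_bigr => p _; rewrite linearZZ.
have uphix0 : \sum_(p <- (m, x) :: s) phi p.1 *: u p.2 = 0.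
  rewrite -[RHS](linear0 u) -phix0 linear_sum.
  by apply: eq_bigr => p _; rewrite linearZZ.
rewrite (key _ (fun p => p.2)) phix0 pure0r add0r.
have := IHl [seq (p.1 - phi p.1 *: e, p.2) | p <- s].
rewrite size_map !big_map; apply=> //.
by rewrite -[RHS]z0 (key _ (fun p => u p.2)) uphix0 pure0r add0r.
Qed.

End Flat.

(** * Tensor products of rings and base change *)

Section TensorRingLift.
Variables (A B C D : comPzRingType).
Variables (f : {rmorphism A -> B}) (g : {rmorphism A -> C}).
Variables (u : {rmorphism B -> D}) (v : {rmorphism C -> D}).
Hypothesis uv : forall a, u (f a) = v (g a).

(** Universal property: the tensor product is the pushout of rings. *)
Lemma tensor_ring_liftP :
  exists w : {rmorphism tensor_ring f g -> D},
    forall b c, w (tpure f g b c) = u b * v c.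
Proof.
pose phi (b : restr f) (c : restr g) : D := u b * v c.
have phiP : balanced phi.
  rewrite /phi; split=> [b b' c|b c c'|a b c].
  - by rewrite rmorphD mulrDl.
  - by rewrite rmorphD mulrDr.
  - by rewrite /GRing.scale /= /restr_scale !rmorphM uv mulrAC mulrC mulrA mulrC.
pose w : tensor_ring f g -> D := tensor_lift phi.
have wD : {morph w : x y / x + y} by exact: tensor_liftD.
have w0 : w 0 = 0 by apply: (addrI (w 0)); rewrite -wD !addr0.
have wE b c : w (tpure f g b c) = u b * v c by exact: tensor_lift_pure.
have wB : zmod_morphism w.
  by move=> x y; apply: (addIr (w y)); rewrite -wD !subrK.
have wM : monoid_morphism w.
  split; first by rewrite -[1]/(tpure f g 1 1) wE !rmorph1 mulr1.
  move=> x y; move: x; apply: tensor_ind => [|x x' Hx Hx'|b c].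
  - by rewrite mul0r !w0 mul0r.
  - by rewrite mulrDl !wD Hx Hx' mulrDl.
  move: y; apply: tensor_ind => [|y y' Hy Hy'|b' c'].
  - by rewrite mulr0 !w0 mulr0.
  - by rewrite mulrDr !wD Hy Hy' mulrDr.
  by rewrite tpureM !wE !rmorphM mulrACA.
pose wB' := GRing.isZmodMorphism.Build _ _ w wB.
pose wM' := GRing.isMonoidMorphism.Build _ _ w wM.
pose W : {rmorphism tensor_ring f g -> D} := HB.pack w wB' wM'.
by exists W.
Qed.

Lemma tpure_scale a b c : tpure f g (f a * b) c = tpure f g b (g a * c).
Proof. exact: (pureZ (a : A) (b : restr f) (c : restr g)). Qed.


Lemma tpureD b b' c : tpure f g (b + b') c = tpure f g b c + tpure f g b' c.
Proof. exact: (@pureDl A (restr f) (restr g)). Qed.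

Lemma tpure0l c : tpure f g 0 c = 0.
Proof. exact: (@pure0l A (restr f) (restr g)). Qed.

Lemma tpure0r b : tpure f g b 0 = 0.
Proof. exact: (@pure0r A (restr f) (restr g)). Qed.

(** When C is the localization of the image of A at a, all elements of the
    tensor product are pure, with denominator a power of a; here s = a^-1. *)
Lemma tensor_ring_localization (a : A) (s : C) : g a * s = 1 ->
    (forall c, exists N a', g a ^+ N * c = g a') ->
  forall z, exists b N, z = tpure f g b (s ^+ N).
Proof.
move=> as1 denom.
have sX N : g a ^+ N * s ^+ N = 1 by rewrite -exprMn as1 expr1n.
apply: tensor_ind => [|x y [b [N ->]] [b' [N' ->]]|b c].
- by exists 0, 0%N; rewrite tpure0l.
- exists (f (a ^+ N') * b + f (a ^+ N) * b'), (N + N')%N.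
  rewrite tpureD !tpure_scale !rmorphXn exprD.
  by rewrite mulrCA sX mulr1 mulrA sX mul1r.
- have [N [a' ec]] := denom c; exists (f a' * b), N.
  by rewrite tpure_scale -ec mulrAC sX mul1r.
Qed.

Lemma tensor_ring_quotient : (forall c, exists a, g a = c) ->
  forall z, exists b, z = tpure f g b 1.
Proof.
move=> g_surj; apply: tensor_ind => [|x y [b ->] [b' ->]|b c].
- by exists 0; rewrite tpure0l.
- by exists (b + b'); rewrite tpureD.
- by have [a <-] := g_surj c; exists (f a * b); rewrite tpure_scale mulr1.
Qed.

End TensorRingLift.

(** Two rings under A that embed in D with the same image, compatibly on A, are
    isomorphic under A. *)
Lemma iso_under_of_images (A B B' D : comPzRingType)
    (f : {rmorphism A -> B}) (f' : {rmorphism A -> B'})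
    (u : {rmorphism B -> D}) (u' : {rmorphism B' -> D}) :
    injective u -> injective u' ->
    (forall y, (exists x, u x = y) <-> (exists x', u' x' = y)) ->
    (forall a, u (f a) = u' (f' a)) ->
  iso_under f f'.
Proof.
move=> u_inj u'_inj img uf.
have hP x : exists x', u' x' = u x by apply/img; exists x.
have hP' x' : exists x, u x = u' x' by apply/img; exists x'.
pose h x := sval (cid (hP x)); pose h' x' := sval (cid (hP' x')).
have hE x : u' (h x) = u x by rewrite /h; case: cid.
have hE' x' : u (h' x') = u' x' by rewrite /h'; case: cid.
have hB : zmod_morphism h by move=> x y; apply: u'_inj; rewrite rmorphB !hE rmorphB.
have hM : monoid_morphism h.
  split; first by apply: u'_inj; rewrite hE !rmorph1.
  by move=> x y; apply: u'_inj; rewrite rmorphM !hE rmorphM.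
pose hB' := GRing.isZmodMorphism.Build _ _ h hB.
pose hM' := GRing.isMonoidMorphism.Build _ _ h hM.
pose H : {rmorphism B -> B'} := HB.pack h hB' hM'.
exists H; split; last by move=> a; apply: u'_inj; rewrite hE uf.
by exists h' => x; [apply: u_inj; rewrite hE' hE | apply: u'_inj; rewrite hE hE'].
Qed.

Section BaseChange.
Variables (A B C B' D : comPzRingType).
Variables (f : {rmorphism A -> B}) (g : {rmorphism A -> C}) (f' : {rmorphism C -> B'}).
Variables (u : {rmorphism B -> D}) (u' : {rmorphism B' -> D}).
Hypothesis uf : forall a, u (f a) = u' (f' (g a)).
Hypothesis u'_inj : injective u'.

(** Base change of B to a localization C of A, identified with a subring B'
    of D whose elements are products of an element of B and one of C. *)
Lemma iso_under_localization (a : A) (s : C) :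
    g a * s = 1 -> (forall c, exists N a', g a ^+ N * c = g a') ->
    injective u ->
    (forall b, exists x, u' x = u b) ->
    (forall x, exists b c, u' x = u b * u' (f' c)) ->
  iso_under (tensor_inr f g) f'.
Proof.
move=> as1 denom u_inj im1 im2.
have [w wE] := tensor_ring_liftP (v := u' \o f') uf.
have elt := tensor_ring_localization (f := f) as1 denom.
apply: (@iso_under_of_images _ _ _ _ _ _ w u') => // [x y exy|y|c].
- apply/eqP; rewrite -subr_eq0; apply/eqP.
  have : w (x - y) = 0 by rewrite rmorphB exy subrr.
  have [b [N ->]] := elt (x - y); rewrite wE /= => ub0.
  have -> : b = 0; last exact: tpure0l.
  apply: u_inj; rewrite rmorph0.
  have <- : u b * u' (f' (s ^+ N)) * u' (f' (g a ^+ N)) = u b.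
    by rewrite -mulrA -!rmorphM -exprMn [s * _]mulrC as1 expr1n !rmorph1 mulr1.
  by rewrite ub0 mul0r.
- split=> [[z <-]|[x <-]].
    have [b [N ->]] := elt z; rewrite wE; have [x <-] := im1 b.
    by exists (x * f' (s ^+ N)); rewrite rmorphM.
  by have [b [c ->]] := im2 x; exists (tpure f g b c); rewrite wE.
- by rewrite wE rmorph1 mul1r.
Qed.

(** Base change of B to a quotient C of A, identified with a subring B' of D:
    u reduces B modulo the kernel of A -> C, and its kernel consists of the
    multiples in B of elements of that kernel. *)
Lemma iso_under_quotient :
    (forall c, exists a, g a = c) ->
    (forall b, u b = 0 -> exists a b', g a = 0 /\ b = f a * b') ->
    (forall y, (exists b, u b = y) <-> (exists x, u' x = y)) ->
  iso_under (tensor_inr f g) f'.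
Proof.
move=> g_surj ker im.
have [w wE] := tensor_ring_liftP (v := u' \o f') uf.
have elt := tensor_ring_quotient (f := f) g_surj.
apply: (@iso_under_of_images _ _ _ _ _ _ w u') => // [x y exy|y|c].
- apply/eqP; rewrite -subr_eq0; apply/eqP.
  have : w (x - y) = 0 by rewrite rmorphB exy subrr.
  have [b ->] := elt (x - y); rewrite wE rmorph1 mulr1 => /ker[a [b' [a0 ->]]].
  by rewrite tpure_scale a0 mul0r tpure0r.
- rewrite -im; split=> [[z <-]|[b <-]].
    by have [b ->] := elt z; exists b; rewrite wE rmorph1 mulr1.
  by exists (tpure f g b 1); rewrite wE rmorph1 mulr1.
- by rewrite wE rmorph1 mul1r.
Qed.

End BaseChange.

(** * Monoid algebras and algebras generated by monomials *)

Lemma gen_subalg_ind (k : comNzRingType) (A : comAlgType k) (G P : A -> Prop) :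
    P 0 -> P 1 -> (forall x y, P x -> P y -> P (x + y)) ->
    (forall (a : k) x, P x -> P (a *: x)) ->
    (forall x y, P x -> P y -> P (x * y)) -> (forall x, G x -> P x) ->
  forall x, x \in gen_subalg G -> P x.
Proof.
move=> P0 P1 PD PZ PM GP x /gen_subalgP.
pose p : {pred A} := fun x => `[< P x >].
have pP : GRing.subsemialg_closed p.
  split; first exact/asboolP.
  - split; first exact/asboolP.
    by move=> y z /asboolP Py /asboolP Pz; apply/asboolP/PD.
  - by move=> a y /asboolP Py; apply/asboolP/PZ.
  - by move=> y z /asboolP Py /asboolP Pz; apply/asboolP/PM.
pose pc := GRing.isSubalgClosed.Build k A p pP.
pose S : subalgClosed A := HB.pack p pc.
by move=> /(_ S) H; apply/asboolP/H => y Gy; apply/asboolP/GP.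
Qed.

Section NatSpan.
Variables (V : nmodType) (g : seq V).

(** The submonoid generated by g: the natural combinations of its members. *)
Definition nat_span : {pred V} := fun v =>
  `[< exists c : nat -> nat, v = \sum_(i < size g) g`_i *+ c i >].

Lemma nat_spanP v : reflect (exists c : nat -> nat,
  v = \sum_(i < size g) g`_i *+ c i) (v \in nat_span).
Proof. exact: asboolP. Qed.

Lemma nat_span_addr : GRing.nmod_closed nat_span.
Proof.
split=> [|x y /nat_spanP[c ->] /nat_spanP[d ->]]; apply/nat_spanP.
  by exists (fun=> 0%N); rewrite big1.
exists (fun i => (c i + d i)%N); rewrite -big_split.
by apply: eq_bigr => i _; rewrite mulrnDr.
Qed.

HB.instance Definition _ := GRing.isAddClosed.Build V nat_span nat_span_addr.

Lemma mem_nat_span v : v \in g -> v \in nat_span.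
Proof.
move=> gv; apply/nat_spanP; exists (fun i => (i == index v g) : nat).
have lt : (index v g < size g)%N by rewrite index_mem.
rewrite (bigD1 (Ordinal lt)) //= eqxx mulr1n nth_index // big1 ?addr0 // => i.
by rewrite -val_eqE /= => /negPf ->.
Qed.

(** The submonoid generated by g, as a type. *)
Definition nat_span_sort : Type := {v : V | v \in nat_span}.
HB.instance Definition _ := SubChoice.on nat_span_sort.
HB.instance Definition _ :=
  GRing.SubChoice_isSubNmodule.Build V _ nat_span_sort nat_span_addr.

Lemma nat_span_fin_gen : exists gs : seq nat_span_sort,
  forall s, exists c : nat -> nat, s = \sum_(i < size gs) gs`_i *+ c i.
Proof.
have valMn (s : nat_span_sort) k : val (s *+ k) = val s *+ k.
  by elim: k => // k IHk; rewrite !mulrS -IHk.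
exists [seq insubd 0 v | v <- g] => s.
have /nat_spanP[c ec] := valP s; exists c; apply: val_inj.
rewrite [LHS]ec raddf_sum size_map /=; apply: eq_bigr => i _.
rewrite [RHS]valMn (nth_map 0) // val_insubd.
by rewrite mem_nat_span ?mem_nth.
Qed.

End NatSpan.

Lemma sum_coeff_delta (k D : nzRingType) (S : choiceType) (T : eqType) (v : S -> T)
    (e : {rmorphism k -> D}) (f : {freeg S / k}) (s : S) : injective v ->
  \sum_(t <- dom f) e (coeff t f) * (v t == v s)%:R = e (coeff s f).
Proof.
move=> v_inj; have [sf|sf] := boolP (s \in dom f).
  rewrite (bigD1_seq s sf (uniq_dom f)) /= eqxx mulr1 big1 ?addr0 // => t ts.
  by rewrite (inj_eq v_inj) (negPf ts) mulr0.
rewrite coeff_outdom // rmorph0 big_seq big1 // => t tf.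
rewrite (inj_eq v_inj) (_ : t == s = false) ?mulr0 //.
by apply: contraNF sf => /eqP <-.
Qed.

Section MonoidAlgLift.
Variables (k D : comNzRingType) (S : nmodType) (e : {rmorphism k -> D}).
Variable X : S -> D.
Hypotheses (X0 : X 0 = 1) (XD : forall s t, X (s + t) = X s * X t).

(** Universal property of the monoid algebra: a morphism of coefficient rings
    and a monoid morphism X to the multiplicative monoid of D induce a ring
    morphism. *)
Lemma monoid_alg_liftP : exists w : {rmorphism monoid_alg k S -> D},
  (forall f : monoid_alg k S, w f = \sum_(s <- dom f) e (coeff s f) * X s) /\
  (forall c s, w (chi c s) = e c * X s).
Proof.
pose w (f : monoid_alg k S) : D := \sum_(s <- dom f) e (coeff s f) * X s.
pose G (c : k) (s : S) := e c * X s.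
have G0 s : G 0 s = 0 by rewrite /G rmorph0 mul0r.
have wE f d : uniq d -> {subset dom f <= d} ->
    w f = \sum_(s <- d) e (coeff s f) * X s.
  exact: (dom_widen G0).
have wB : zmod_morphism w.
  move=> f g; pose d := undup (dom f ++ dom g ++ dom (f - g)).
  have ud : uniq d by apply: undup_uniq.
  have [sf sg sfg] : [/\ {subset dom f <= d}, {subset dom g <= d}
      & {subset dom (f - g) <= d}].
    by split=> s; rewrite mem_undup !mem_cat => ->; rewrite ?orbT.
  rewrite (wE _ d ud sf) (wE _ d ud sg) (wE _ d ud sfg).
  rewrite -sumrB; apply: eq_bigr => s _.
  by rewrite coeffB rmorphB mulrBl.
have w0 : w 0 = 0 by rewrite -(subrr (0 : monoid_alg k S)) wB subrr.
have wD f g : w (f + g) = w f + w g.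
  by rewrite -[g in LHS]opprK wB -[- g]sub0r wB w0 sub0r opprK.
have wchi c s : w (chi c s) = e c * X s.
  rewrite (wE _ [:: s]) //; last first.
    move=> v; rewrite mem_dom /chi coeffU inE [v == s]eq_sym.
    by case: (s == v) => //; rewrite mulr0 eqxx.
  by rewrite big_seq1 /chi coeffU eqxx mulr1.
have wM : monoid_morphism w.
  split; first by rewrite [w 1](wchi 1 0) rmorph1 X0 mulr1.
  move=> f g; move: f; apply: chi_ind => [|f f' Hf Hf'|a s].
  - by rewrite mul0r w0 mul0r.
  - by rewrite mulrDl !wD Hf Hf' mulrDl.
  move: g; apply: chi_ind => [|g g' Hg Hg'|b t].
  - by rewrite mulr0 w0 mulr0.
  - by rewrite mulrDr !wD Hg Hg' mulrDr.
  by rewrite [chi a s * chi b t]chiM !wchi rmorphM XD mulrACA.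
pose wB' := GRing.isZmodMorphism.Build _ _ w wB.
pose wM' := GRing.isMonoidMorphism.Build _ _ w wM.
pose W : {rmorphism monoid_alg k S -> D} := HB.pack w wB' wM'.
by exists W.
Qed.

End MonoidAlgLift.

(** Exponents of monomials form a commutative monoid under addition. *)
HB.instance Definition _ n := GRing.isNmodule.Build 'X_{1..n}
  (@addmA n) (@addmC n) (@add0m n).

Section Exponents.
Variables (n : nat) (ms : seq 'X_{1..n}).
Local Notation S := (nat_span_sort ms).

Lemma nat_span_affine : affine_semigroup S.
Proof.
split; first exact: nat_span_fin_gen.
pose e (s : S) : 'rV[int]_n := \row_i (val s i)%:Z.
have eD : GRing.nmod_morphism e.
  split; first by apply/rowP => i; rewrite !mxE mnm0E.
  by move=> s t; apply/rowP => i; rewrite !mxE mnmDE PoszD.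
pose eD' := GRing.isNmodMorphism.Build _ _ e eD.
pose E : {additive S -> 'rV[int]_n} := HB.pack e eD'.
exists n, E => s t /rowP est; apply/val_inj/mnmP => i.
by have := est i; rewrite !mxE => -[].
Qed.

Variables (F : fieldType).

Lemma mpolyX_nat_span (U : subalgClosed {mpoly F[n]}) :
  (forall m, m \in ms -> 'X_[m] \in U) ->
  forall m, m \in nat_span ms -> 'X_[m] \in U.
Proof.
move=> msU m /nat_spanP[c ->].
elim/big_rec: _ => [|i x _ xU]; first by rewrite mpolyX0 rpred1.
have XM a k : 'X_[a] \in U -> 'X_[(a *+ k)%R] \in U.
  move=> aU; elim: k => [|k IHk]; first by rewrite mulr0n mpolyX0 rpred1.
  by rewrite mulrS mpolyXD rpredM.
by rewrite mpolyXD rpredM // XM // msU // mem_nth.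
Qed.

Variables (k : comNzRingType) (e : {rmorphism k -> F}).
Hypothesis e_bij : bijective e.

(** The algebra of the monoid generated by ms embeds in the polynomial ring, onto
    the polynomials all of whose exponents lie in that monoid. The coefficients
    are transported along a bijection e to F. *)
Lemma monoid_alg_to_mpoly : exists w : {rmorphism monoid_alg k S -> {mpoly F[n]}},
  [/\ injective w,
      forall p, (exists f, w f = p) <-> {subset msupp p <= nat_span ms}
    & forall a, w (GRing.in_alg _ a) = (e a)%:MP].
Proof.
have X0 : 'X_[val (0 : S)] = 1 :> {mpoly F[n]} by rewrite mpolyX0.
have XD (s t : S) : 'X_[val (s + t)%R] = 'X_[val s] * 'X_[val t] :> {mpoly F[n]}.
  by rewrite mpolyXD.
have [w [wE' wchi']] := monoid_alg_liftP (X := fun s : S => 'X_[val s])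
  ((@mpolyC n F) \o e) X0 XD.
have wE f : w f = \sum_(s <- dom f) e (coeff s f) *: 'X_[val s].
  by rewrite wE'; apply: eq_bigr => s _; rewrite /= mul_mpolyC.
have wchi c s : w (chi c s) = e c *: 'X_[val s].
  by rewrite wchi' /= mul_mpolyC.
have wsum f m : (w f)@_m = \sum_(s <- dom f) e (coeff s f) * (val s == m)%:R.
  rewrite wE raddf_sum; apply: eq_bigr => s _.
  by rewrite [LHS]mcoeffZ mcoeffX.
have wcoef f s : (w f)@_(val s) = e (coeff s f).
  by rewrite wsum; exact: sum_coeff_delta val_inj.
have wsupp f m : m \notin nat_span ms -> (w f)@_m = 0.
  move=> mS; rewrite wsum; apply: big1 => t _.
  have /negPf-> : val t != m by apply: contraNneq mS => <-; exact: valP.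
  exact: mulr0.
exists w; split.
- move=> f g fg; apply/eqP/freeg_eqP => s; apply: (bij_inj e_bij).
  by rewrite -!wcoef fg.
- move=> p; split=> [[f <-] m|pS].
    by rewrite mcoeff_msupp; apply: contraR => /wsupp ->.
  have [e' _ e'K] := e_bij.
  exists (\sum_(m <- msupp p) chi (e' p@_m) (insubd (0 : S) m)).
  rewrite rmorph_sum [RHS]mpolyE big_seq [RHS]big_seq; apply: eq_bigr => m mp /=.
  have [s sm] : exists s : S, val s = m.
    by exists (Sub m (pS m mp)); exact: SubK.
  by rewrite -{2}sm valKd wchi e'K sm.
- move=> a; rewrite /GRing.in_alg /= [1]/(chi 1 0) chiZ mulr1 wchi.
  by rewrite mpolyX0 -mul_mpolyC mulr1.
Qed.

End Exponents.

Section MonomialAlgebra.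
Variables (F : fieldType) (n : nat).

(** An algebra generated by nonzero multiples of the monomials with exponents in
    ms is spanned by the monomials with exponents in the monoid generated by
    ms. *)
Lemma monomial_algebraP (G : {mpoly F[n]} -> Prop) (ms : seq 'X_{1..n}) :
    (forall g, G g -> exists c m, m \in ms /\ g = c *: 'X_[m]) ->
    (forall m, m \in ms -> exists2 c, c != 0 & G (c *: 'X_[m])) ->
  forall p, p \in gen_subalg G <-> {subset msupp p <= nat_span ms}.
Proof.
move=> Gms msG p; split; last first.
  move=> sp; rewrite [p]mpolyE big_seq; apply: rpred_sum => m /sp mS.
  apply: rpredZ; apply: (mpolyX_nat_span (U := gen_subalg G)) mS => m' /msG[c c0 Gc].
  have -> : 'X_[m'] = c^-1 *: (c *: 'X_[m']) :> {mpoly F[n]}.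
    by rewrite scalerA mulVf // scale1r.
  exact/rpredZ/mem_gen_subalg.
move: p; apply: gen_subalg_ind =>
    [||x y xS yS|a x xS|x y xS yS|x /Gms[c [m [mms ->]]]] m'.
- by rewrite msupp0.
- by rewrite msupp1 inE => /eqP ->; exact: (rpred0 (nat_span ms)).
- by move/msuppD_le; rewrite mem_cat => /orP[/xS|/yS].
- by move/msuppZ_le/xS.
- by move/msuppM_le/allpairsP => [[m1 m2] /= [/xS m1S /yS m2S ->]]; exact: rpredD.
- by move/msuppZ_le; rewrite msuppX inE => /eqP ->; exact: mem_nat_span.
Qed.

End MonomialAlgebra.

(** * The valuation ring of F(t) *)

Section ValuationRing.
Variable F : fieldType.
Local Notation K := (ratfun F).
Local Notation O := (valring F).

Lemma defined_at0_valring (c : O) : defined_at0 (val c).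
Proof. exact/valring_predP/valP. Qed.

(** Evaluation at t = 0, as a ring morphism on the valuation ring. *)
Definition ev0 (c : O) : F := at0 (val c).

Lemma ev0_is (c : O) : at0_is (val c) (ev0 c).
Proof. exact/at0E/defined_at0_valring. Qed.

Lemma ev0_zmod : zmod_morphism ev0.
Proof. by move=> c d; apply: at0P; apply: at0_isB; apply: ev0_is. Qed.

Lemma ev0_monoid : monoid_morphism ev0.
Proof.
split; first exact/at0P/at0_is1.
by move=> c d; apply: at0P; apply: at0_isM; apply: ev0_is.
Qed.

HB.instance Definition _ := GRing.isZmodMorphism.Build O F ev0 ev0_zmod.
HB.instance Definition _ := GRing.isMonoidMorphism.Build O F ev0 ev0_monoid.

Lemma valring_incl_inj : injective (@valring_incl F).
Proof. exact: val_inj. Qed.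

Lemma residue_surj (x : residue_ring F) : exists c : O, residue c = x.
Proof. by elim/quotW: x => c; exists c. Qed.

(** Evaluation at 0 identifies the residue field with F. *)
Lemma residue_fieldP : exists e : {rmorphism residue_ring F -> F},
  (forall c, e (residue c) = ev0 c) /\ bijective e.
Proof.
pose e (x : residue_ring F) : F := ev0 (sval (cid (residue_surj x))).
have eE c : e (residue c) = ev0 c.
  by rewrite /e; case: cid => d /= /residue_eq.
have eB : zmod_morphism e.
  move=> x y; have [[c <-] [d <-]] := (residue_surj x, residue_surj y).
  by rewrite -rmorphB !eE rmorphB.
have eM : monoid_morphism e.
  split; first by rewrite -(rmorph1 (@residue F)) eE rmorph1.
  move=> x y; have [[c <-] [d <-]] := (residue_surj x, residue_surj y).
  by rewrite -rmorphM !eE rmorphM.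
pose eB' := GRing.isZmodMorphism.Build _ _ e eB.
pose eM' := GRing.isMonoidMorphism.Build _ _ e eM.
pose E : {rmorphism residue_ring F -> F} := HB.pack e eB' eM'.
exists E; split=> //.
pose e' (a : F) := residue (sval (cid (at0_surj a))).
have e'K : cancel e' E.
  by move=> a; rewrite /e' [LHS]eE; case: cid.
exists e' => // x; have [c <-] := residue_surj x.
by apply/residue_eq; case: cid => d /= ->; rewrite eE.
Qed.

Lemma tvar_valring : tvar F \in @valring_pred F.
Proof.
by apply/valring_predP; exists 0; have := at0_isX F 1; rewrite expr1.
Qed.

(** The uniformizer t as an element of the valuation ring. *)
Definition tO : O := exist (fun x => x \in @valring_pred F) _ tvar_valring.

Lemma residue_tO : residue tO = 0.
Proof.
rewrite -(rmorph0 (@residue F)); apply/residue_eq => /=.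
by rewrite (at0P (at0_is0 F)); have := at0P (at0_isX F 1); rewrite expr1.
Qed.

Lemma dvd_tO (c : O) : ev0 c = 0 -> exists d, c = tO * d.
Proof.
have [-> _|c0] := eqVneq c 0; first by exists 0; rewrite mulr0.
have cv0 : val c != 0 by rewrite -val_eqE in c0.
move=> ec; have D : (tvar F)^-1 * val c \in @valring_pred F.
  have : c \in @maxideal F by rewrite maxidealP; apply/eqP.
  rewrite unfold_in (negPf cv0) /= => v.
  have [/at0E D _] := is_val_tval cv0.
  apply/valring_predP.
  have -> : (tvar F)^-1 * val c = tvar F ^+ `|tval (val c) - 1|%N *
      (tvar F ^ (- tval (val c)) * val c).
    rewrite mulrA exprnP gez0_abs ?subr_ge0 ?gtz0_ge1 //.
    rewrite -expfzDr ?tvar_neq0 // addrAC subrr add0r.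
    by rewrite exprN1.
  by eexists; apply: at0_isM (at0_isX F _) D.
exists (exist (fun x => x \in @valring_pred F) _ D); apply: val_inj => /=.
by rewrite mulrA divff ?mul1r ?tvar_neq0.
Qed.

Lemma ev0_inv (c : O) : ev0 c != 0 -> exists d, c * d = 1.
Proof.
move=> c0; have D := at0_isV (ev0_is c) c0.
have Dp : (val c)^-1 \in @valring_pred F by apply/valring_predP; eexists; apply: D.
exists (exist (fun x => x \in @valring_pred F) _ Dp); apply: val_inj => /=.
apply: divff; apply: contraNneq c0 => c0.
by apply/eqP/at0P; have -> : val c = 0 by []; apply: at0_is0.
Qed.

Lemma ratfun_common_denom (x : K) : exists N (c : O), tvar F ^+ N * x = val c.
Proof.
have [->|x0] := eqVneq x 0; first by exists 0, 0; rewrite mulr0.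
have [D _] := is_val_tval x0.
have Dp : tvar F ^+ `|tval x| * x \in @valring_pred F.
  apply/valring_predP.
  have -> : tvar F ^+ `|tval x| * x =
      tvar F ^+ `| (`|tval x|%N : int) + tval x| * (tvar F ^ (- tval x) * x).
    rewrite mulrA !exprnP -expfzDr ?tvar_neq0 //; congr (tvar F ^ _ * x).
    rewrite [X in _ = X - _]gez0_abs ?addrK //.
    by rewrite abszE -lerBlDr sub0r -normrN ler_norm.
  by eexists; apply: at0_isM (at0_isX F _) (at0E D).
by exists `|tval x|%N, (exist (fun x => x \in @valring_pred F) _ Dp).
Qed.

End ValuationRing.

(** * Normalization and the model over the valuation ring *)

Section Normalization.
Variables (F : fieldType) (n : nat).
Local Notation K := (ratfun F).
Local Notation O := (valring F).
Local Notation incl := (map_mpoly (@valring_incl F)).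
Local Notation t := (tvar F).

Lemma mcoeff_incl (g : {mpoly O[n]}) m : (incl g)@_m = valring_incl g@_m.
Proof. exact: mcoeff_map_mpoly. Qed.

Lemma incl_inj : injective (incl : {mpoly O[n]} -> {mpoly K[n]}).
Proof.
move=> g h e; apply/mpolyP => m; apply: (@valring_incl_inj F).
by rewrite -mcoeff_incl e mcoeff_incl.
Qed.

Lemma incl_lift (f : {mpoly K[n]}) :
  (forall m, f@_m \in @valring_pred F) -> exists g : {mpoly O[n]}, incl g = f.
Proof.
move=> fO; pose c m : O := exist (fun x => x \in @valring_pred F) _ (fO m).
exists (\sum_(m <- msupp f) c m *: 'X_[m]).
rewrite rmorph_sum [RHS]mpolyE; apply: eq_bigr => m _ /=.
by rewrite map_mpolyZ map_mpolyX.
Qed.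

Lemma trop_attained (f : {mpoly K[n]}) : f != 0 ->
  (exists2 m, m \in msupp f & tval f@_m = trop f) /\
  {in msupp f, forall m, trop f <= tval f@_m}.
Proof.
move=> f0; rewrite /trop; split; last first.
  move=> m; elim: (msupp f) => // m' s IHs; rewrite inE big_cons ge_min.
  by case/predU1P => [->|/IHs ->]; [rewrite lexx | rewrite orbT].
(* Induction on a sublist of the support; on the empty list the minimum is its
   default value, which is attained at mlead f. *)
suff : {subset msupp f <= msupp f} -> exists2 m, m \in msupp f & tval f@_m =
    \big[Order.min/tval (mleadc f)]_(m <- msupp f) tval f@_m by apply.
elim: {1 4}(msupp f) => [_|m s IHs sub].
  by exists (mlead f); rewrite ?big_nil // mlead_supp.
have [m' m's e] : exists2 m, m \in msupp f & tval f@_m =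
    \big[Order.min/tval (mleadc f)]_(m <- s) tval f@_m.
  by apply: IHs => m' m's; apply: sub; rewrite inE m's orbT.
rewrite big_cons -e minEle; case: ifP => _; last by exists m'.
by exists m => //; apply: sub; rewrite inE eqxx.
Qed.

(** The normalization of f has coefficients in the valuation ring, not all of
    which vanish at t = 0. *)
Lemma normalize_lift (f : {mpoly K[n]}) : f != 0 ->
  exists g : {mpoly O[n]}, incl g = normalize f /\ exists m, ev0 g@_m != 0.
Proof.
move=> f0; have [[m mf em] le_trop] := trop_attained f0.
have H m' : (normalize f)@_m' \in @valring_pred F.
  rewrite mcoeffZ; have [m'f|/memN_msupp_eq0 ->] := boolP (m' \in msupp f);
    last by rewrite mulr0 rpred0.
  have f'0 : f@_m' != 0 by rewrite -mcoeff_msupp.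
  have [/at0E D _] := is_val_tval f'0.
  apply/valring_predP.
  have -> : t ^ (- trop f) * f@_m' = t ^+ `|tval f@_m' - trop f|%N *
      (t ^ (- tval f@_m') * f@_m').
    rewrite mulrA exprnP gez0_abs ?subr_ge0 ?le_trop //.
    by rewrite -expfzDr ?tvar_neq0 // addrAC subrr add0r.
  by eexists; apply: at0_isM (at0_isX F _) D.
have [g eg] := incl_lift H; exists g; split=> //; exists m.
have -> : ev0 g@_m = at0 (t ^ (- trop f) * f@_m).
  by rewrite -mcoeffZ -/(normalize f) -eg mcoeff_map_mpoly.
have /is_val_tval[_] : f@_m != 0 by rewrite -mcoeff_msupp.
by rewrite em.
Qed.

Lemma trop_ge0 (g : {mpoly O[n]}) : incl g != 0 -> 0 <= trop (incl g).
Proof.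
move=> /trop_attained[[m mg <-] _].
have g0 : (incl g)@_m != 0 by rewrite -mcoeff_msupp.
move: g0; rewrite mcoeff_map_mpoly => g0.
by have /defined_at0_val[/eqP|//] := defined_at0_valring g@_m; rewrite (negPf g0).
Qed.

Lemma normalizeK (f : {mpoly K[n]}) : t ^ trop f *: normalize f = f.
Proof. by rewrite scalerA -expfzDr ?tvar_neq0 // subrr expr0z scale1r. Qed.

Lemma initial_formE (f : {mpoly K[n]}) (g : {mpoly O[n]}) :
  incl g = normalize f -> initial_form f = map_mpoly (@ev0 F) g.
Proof.
move=> eg; rewrite /initial_form -eg /map_mpoly /mmap.
rewrite (perm_big _ (msupp_map_mpoly g (@valring_incl_inj F))) /=.
by apply: eq_bigr => m _; rewrite mcoeff_map_mpoly.
Qed.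

(** g is a multiple of its normalization e, and the factor can be read off any
    coefficient at which e is invertible, by a linear form in g. *)
Lemma normalize_proportional (g e : {mpoly O[n]}) m (d : O) :
  incl e = normalize (incl g) -> e@_m * d = 1 -> g = (d * g@_m) *: e.
Proof.
move=> ee ed; apply: incl_inj; rewrite map_mpolyZ.
have eg : incl g = t ^ trop (incl g) *: incl e by rewrite ee normalizeK.
have ec : valring_incl (d * g@_m) = t ^ trop (incl g).
  have em : valring_incl g@_m = t ^ trop (incl g) * valring_incl e@_m.
    by rewrite -[in LHS]mcoeff_incl eg mcoeffZ mcoeff_incl -eg.
  rewrite rmorphM /= em mulrCA -rmorphM.
  by rewrite [d * _]mulrC ed rmorph1 mulr1.
exact: etrans eg (congr1 (fun c => c *: incl e) (esym ec)).
Qed.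

Lemma mpoly_dvd_tO (g : {mpoly O[n]}) : (forall m, ev0 g@_m = 0) ->
  exists h, g = tO F *: h.
Proof.
move=> g0; have cP m : {c : O | g@_m = tO F * c}.
  exact/cid/dvd_tO/g0.
exists (\sum_(m <- msupp g) sval (cP m) *: 'X_[m]).
rewrite [LHS]mpolyE scaler_sumr; apply: eq_bigr => m _.
by rewrite scalerA; case: (cP m) => c /= ->.
Qed.

End Normalization.

Section Model.
Variables (F : fieldType) (n : nat) (R : subalgClosed {mpoly (ratfun F)[n]}).
Local Notation K := (ratfun F).
Local Notation O := (valring F).
Local Notation incl := (map_mpoly (@valring_incl F)).
Local Notation t := (tvar F).
Local Notation M := (model R).
Local Notation inM := (GRing.in_alg M).

(** The model is the intersection of R with the polynomials over the valuation
    ring. *)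
Lemma mem_model (g : {mpoly O[n]}) : (g \in model_pred R) = (incl g \in R).
Proof.
apply/idP/idP.
  move: g.
  have RD (x y : {mpoly O[n]}) : incl x \in R -> incl y \in R -> incl (x + y) \in R.
    by move=> Rx Ry; rewrite rmorphD; exact: rpredD Rx Ry.
  have RM (x y : {mpoly O[n]}) : incl x \in R -> incl y \in R -> incl (x * y) \in R.
    by move=> Rx Ry; rewrite rmorphM; exact: rpredM Rx Ry.
  have RZ (a : O) (x : {mpoly O[n]}) : incl x \in R -> incl (a *: x) \in R.
    by move=> Rx; rewrite map_mpolyZ; exact: rpredZ Rx.
  have R0 : incl (0 : {mpoly O[n]}) \in R by rewrite rmorph0; exact: rpred0.
  have R1 : incl (1 : {mpoly O[n]}) \in R by rewrite rmorph1; exact: rpred1.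
  apply: (gen_subalg_ind R0 R1 RD RZ RM) => x [f [Rf _ ->]].
  exact: rpredZ Rf.
have [/eqP|g0 Rg] := eqVneq (incl g) 0.
  rewrite -(rmorph0 incl) (inj_eq (@incl_inj F n)) => /eqP -> _; exact: rpred0.
have [h [eh _]] := normalize_lift g0.
have -> : g = tO F ^+ `|trop (incl g)| *: h.
  apply: incl_inj; rewrite map_mpolyZ eh rmorphXn /=.
  rewrite -[LHS]normalizeK; congr (_ *: _).
  by rewrite exprnP gez0_abs // trop_ge0.
by apply/rpredZ/mem_gen_subalg; exists (incl g).
Qed.

(** The inclusion of the model in the polynomials over the valuation ring. *)
Definition model_val (g : M) : {mpoly O[n]} := val g.

Lemma model_val_zmod : zmod_morphism model_val. Proof. by []. Qed.
Lemma model_val_monoid : monoid_morphism model_val. Proof. by []. Qed.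
HB.instance Definition _ :=
  GRing.isZmodMorphism.Build M {mpoly O[n]} model_val model_val_zmod.
HB.instance Definition _ :=
  GRing.isMonoidMorphism.Build M {mpoly O[n]} model_val model_val_monoid.

Lemma model_val_inj : injective model_val. Proof. exact: val_inj. Qed.

Lemma model_valZ (a : O) (g : M) : model_val (a *: g) = a *: model_val g.
Proof. by []. Qed.

Lemma model_val_alg (a : O) : model_val (inM a) = a%:MP.
Proof. by rewrite model_valZ rmorph1 -mul_mpolyC mulr1. Qed.

Lemma inM_mul (a : O) (g : M) : inM a * g = a *: g.
Proof. exact: mulr_algl. Qed.

Lemma model_incl (g : M) : incl (model_val g) \in R.
Proof. by rewrite -mem_model; exact: valP g. Qed.

Lemma model_normalize (f : {mpoly K[n]}) : f \in R -> f != 0 ->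
  exists g : M, incl (model_val g) = normalize f /\
    exists m, ev0 (model_val g)@_m != 0.
Proof.
move=> Rf /normalize_lift[g [eg gm]].
have gM : g \in model_pred R by rewrite mem_model eg; exact: rpredZ Rf.
by exists (exist (fun x => x \in model_pred R) _ gM).
Qed.

(** The model is saturated: its elements that are divisible by t as polynomials
    are divisible by t in the model. *)
Lemma model_saturated (g : M) : (forall m, ev0 (model_val g)@_m = 0) ->
  exists h : M, g = tO F *: h.
Proof.
move=> /mpoly_dvd_tO[h eh].
have Rg := model_incl g.
have hM : h \in model_pred R.
  rewrite mem_model; have -> : incl h = t^-1 *: incl (model_val g).
    by rewrite eh map_mpolyZ scalerA mulVf ?tvar_neq0 // scale1r.
  exact: rpredZ Rg.
exists (exist (fun x => x \in model_pred R) h hM); exact: model_val_inj.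
Qed.

End Model.

(** * Flatness and the generic fibre *)

Section Fibres.
Variables (F : fieldType) (n : nat) (R : subalgClosed {mpoly (ratfun F)[n]}).
Local Notation K := (ratfun F).
Local Notation O := (valring F).
Local Notation incl := (map_mpoly (@valring_incl F)).
Local Notation t := (tvar F).
Local Notation M := (model R).
Local Notation inM := (GRing.in_alg M).

Lemma model_flat : flat inM.
Proof.
apply: flat_of_functionals => m.
pose phi (mu : 'X_{1..n}) (d : O) (x : restr inM) : O^o :=
  d * (model_val (x : M))@_mu.
have phi_lin mu d : linear (phi mu d).
  move=> a x y; rewrite /phi.
  have -> : model_val (a *: x + y : restr inM) = a *: model_val x + model_val y.
    by rewrite -model_valZ -inM_mul.
  by rewrite mcoeffD mcoeffZ mulrDr mulrCA.
pose phiL mu d := GRing.isLinear.Build O (restr inM) O^o *:%R (phi mu d) (phi_lin mu d).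
pose Phi mu d : {linear restr inM -> O^o} := HB.pack (phi mu d) (phiL mu d).
(* The required form is a multiple of a coefficient function, with mu and d
   chosen so that it is 1 at the normalization e of m; for m = 0 any form does,
   with e = 0. *)
have [m0|m0] := eqVneq (incl (model_val m)) 0.
  exists 0, (Phi 0%MM 0); rewrite scaler0.
  apply: model_val_inj; apply: (@incl_inj F n).
  by rewrite m0 !rmorph0.
have [e [eE [mu /ev0_inv[d ed]]]] := model_normalize (model_incl m) m0.
exists e, (Phi mu d); apply: model_val_inj.
rewrite -[RHS]/(model_val (inM (d * (model_val m)@_mu) * e)) inM_mul model_valZ.
exact: normalize_proportional eE ed.
Qed.

Lemma generic_fibre :
  iso_under (tensor_inr inM (@valring_incl F)) (GRing.in_alg (subalg_sort R)).
Proof.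
pose u : {rmorphism M -> {mpoly K[n]}} := incl \o @model_val F n R.
pose u' : {rmorphism subalg_sort R -> {mpoly K[n]}} := val.
have uE g : u g = incl (model_val g) by [].
have u'1 (c : K) : u' (GRing.in_alg (subalg_sort R) c) = c%:MP.
  by rewrite -[RHS]mulr1 mul_mpolyC.
apply: (@iso_under_localization _ _ _ _ _ _ _ _ u u' _ _ (tO F) t^-1).
- by move=> a; rewrite u'1 uE model_val_alg map_mpolyC.
- exact: val_inj.
- exact/divff/tvar_neq0.
- exact: ratfun_common_denom.
- by move=> g h e; apply: model_val_inj; exact: (@incl_inj F n).
- by move=> g; exists (exist (fun x => x \in R) _ (model_incl g)).
- move=> f; have [f0|f0] := eqVneq (val f) 0.
    by exists 0, 0; rewrite rmorph0 mul0r.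
  have [g [gE _]] := model_normalize (valP f) f0.
  exists g, (t ^ trop (val f)).
  by rewrite u'1 uE gE mulrC mul_mpolyC normalizeK.
Qed.

End Fibres.

(** * The special fibre *)

Section SpecialFibre.
Variables (F : fieldType) (n : nat) (R : subalgClosed {mpoly (ratfun F)[n]}).
Local Notation K := (ratfun F).
Local Notation O := (valring F).
Local Notation incl := (map_mpoly (@valring_incl F)).
Local Notation M := (model R).
Local Notation inM := (GRing.in_alg M).

(** Reduction of the model modulo t, into the polynomials over F. *)
Definition reduction : {rmorphism M -> {mpoly F[n]}} :=
  map_mpoly (@ev0 F) \o @model_val F n R.

Lemma reductionE g : reduction g = map_mpoly (@ev0 F) (model_val g).
Proof. by []. Qed.

Lemma reductionZ a g : reduction (a *: g) = ev0 a *: reduction g.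
Proof. by rewrite !reductionE model_valZ map_mpolyZ. Qed.

Lemma reduction_alg a : reduction (inM a) = (ev0 a)%:MP.
Proof. by rewrite reductionE model_val_alg map_mpolyC. Qed.

Lemma reduction_ker g : reduction g = 0 -> exists h, g = tO F *: h.
Proof.
move=> g0; apply: model_saturated => m.
by rewrite -mcoeff_map_mpoly -reductionE g0 mcoeff0.
Qed.

(** The initial algebra is the reduction of the model; in particular every
    element of it lifts. *)
Lemma reduction_image p :
  (exists g, reduction g = p) <-> p \in initial_algebra R.
Proof.
split=> [[g <-]|].
  have [g0|g0] := eqVneq (incl (model_val g)) 0.
    have -> : g = 0; last by rewrite rmorph0; exact: rpred0.
    by apply: model_val_inj; apply: (@incl_inj F n); rewrite g0 !rmorph0.
  have [h [hE [m /ev0_inv[d md]]]] := model_normalize (model_incl g) g0.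
  rewrite reductionE (normalize_proportional hE md) map_mpolyZ.
  apply/rpredZ/mem_gen_subalg; exists (incl (model_val g)).
  by split; [exact: model_incl | exact: g0 | rewrite (initial_formE hE)].
move: p; apply: gen_subalg_ind.
- by exists 0; rewrite rmorph0.
- by exists 1; rewrite rmorph1.
- by move=> _ _ [g <-] [h <-]; exists (g + h); rewrite rmorphD.
- move=> a _ [g <-]; have [c <-] := at0_surj a.
  by exists (c *: g); rewrite reductionZ.
- by move=> _ _ [g <-] [h <-]; exists (g * h); rewrite rmorphM.
- move=> _ [f [Rf f0 ->]]; have [g [gE _]] := model_normalize Rf f0.
  by exists g; rewrite (initial_formE gE).
Qed.

Lemma special_fibre (B : seq {mpoly K[n]}) :
  khovanskii_basis R (fun f => f \in B) ->
  affine_toric (tensor_inr inM (@residue F)).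
Proof.
move=> [Bmon inRE]; pose ms := [seq mlead (initial_form f) | f <- B].
(* The semigroup is generated by the exponents of the initial forms of B; as
   these are monomials, the leading exponent is the only one. *)
have Bms f : f \in B -> exists2 c, c != 0 &
    initial_form f = c *: 'X_[mlead (initial_form f)].
  by move=> /Bmon[_ _ [c [m [c0 ->]]]]; exists c; rewrite // mleadZ ?mleadXm.
have inRP p : p \in initial_algebra R <-> {subset msupp p <= nat_span ms}.
  rewrite inRE; apply: monomial_algebraP => [_ [f [Bf ->]]|m /mapP[f Bf ->]].
    have [c _ ef] := Bms f Bf; exists c, (mlead (initial_form f)); split=> //.
    exact: map_f.
  by have [c c0 ef] := Bms f Bf; exists c => //; exists f.
have [e [eE e_bij]] := residue_fieldP F.
have [w [w_inj wim wC]] := monoid_alg_to_mpoly ms e_bij.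
exists (nat_span_sort ms); split; first exact: nat_span_affine.
apply: (@iso_under_quotient _ _ _ _ _ _ _ _ reduction w) => //.
- by move=> a; rewrite reduction_alg wC eE.
- exact: residue_surj.
- move=> g /reduction_ker[h ->]; exists (tO F), h; split; first exact: residue_tO.
  by rewrite inM_mul.
- by move=> p; rewrite reduction_image inRP wim.
Qed.

End SpecialFibre.

Theorem theorem3p3 (F : fieldType) (charF : [pchar F] =i pred0) (n : nat)
    (R : subalgClosed {mpoly (ratfun F)[n]})
    (B : seq {mpoly (ratfun F)[n]})
    (BP : khovanskii_basis R (fun f => f \in B)) :
  [/\ flat (GRing.in_alg (model R)),
      iso_under
        (tensor_inr (GRing.in_alg (model R)) (@valring_incl F))
        (GRing.in_alg (subalg_sort R))
    & affine_toric
        (tensor_inr (GRing.in_alg (model R)) (@residue F))].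
Proof.
split; [exact: model_flat | exact: generic_fibre | exact: special_fibre BP].
Qed.
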